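(* Let $\lambda=(\lambda_1,\dots,\lambda_K)\in\Lambda$. Then the allocation vector $p^n=(p^n_k)_{1\le k\le K}$ generated by the update $$p^{n+1}=\big[p^n+\beta^n\,\tilde E^n(I-R^T)^{-1}\Delta Q^{n+1}\big]_{\mathcal C_{\varepsilon_0}}$$ converges almost surely, as $n\to\infty$, to $p^*=(p^*_k)_{1\le k\le K}$, where $p^*_k=\nu_k/\mu_k$.
   Context: Network. There are $K$ queues and $J$ servers. $\mathcal S_k\neq\emptyset$ is the set of servers able to serve queue $k$, and $\mathcal T_j=\{k:j\in\mathcal S_k\}\ne\emptyset$. For $j\in\mathcal S_k$ the service rate is $\mu_{kj}=\mu_k\alpha_j$ with finite $\mu_k,\alpha_j>0$, and (after scaling time) $\sum_{j\in\mathcal S_k}\mu_{kj}p_{kj}<1$ for every $k$ and every feasible $(p_{kj})$ (i.e. $p_{kj}\ge0$, $\sum_{k\in\mathcal T_j}p_{kj}\le1$ for all $j$). Exogenous arrivals to queue $k$ have rate $\lambda_k\in[0,1]$. $R=[r_{k'k}]$ is the $K\times K$ routing matrix: $r_{k'k}\ge0$ is the probability that a task completing service at queue $k'$ joins queue $k$ ($\sum_kr_{k'k}\le1$; with the remaining probability it leaves). The network is open: $I-R^T$ is invertible. Nominal rates: $\nu=(I-R^T)^{-1}\lambda$; it is assumed that $\nu_k>0$ for all $k$. Capacity region. $\Lambda$ is the set of $\lambda\in\mathbb R_+^K$ for which there exist $p_{kj}\ge0$ with $\sum_{k\in\mathcal T_j}p_{kj}\le1$ for all $j$ and $\nu_k\le\sum_{j\in\mathcal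 S_k}\mu_{kj}p_{kj}$ for all $k$. Dynamics (discrete time $n=0,1,2,\dots$). Queue lengths $Q^n_k$ are non-negative integers with arbitrary deterministic initial values, and $$Q^{n+1}_k=Q^n_k+a^n_k+\sum_{k'=1}^Kd^n_{k'}\mathbf 1^n_{k'\to k}-d^n_k,\qquad \Delta Q^{n+1}=Q^{n+1}-Q^n ,$$ where $a^n_k\in\{0,1\}$ is the number of exogenous arrivals, $d^n_k=s^n_k\mathbf 1_{\{Q^n_k>0\}}$ the number of departures from queue $k$, and $\mathbf 1^n_{k'\to k}$ the indicator that a task leaving queue $k'$ at time $n$ goes to queue $k$ (at most one $k$ for each $k'$, $n$). Conditionally on the history up to time $n$ (all queue lengths and allocation vectors at times $\le n$), the $a^n_k$, the $s^n_k$ and the routing decisions from the different queues are independent, with $a^n_k$ Bernoulli($\lambda_k$), $s^n_k$ Bernoulli($\mu_kp^n_k$), and $\mathbf 1^n_{k'\to k}$ Bernoulli($r_{k'k}$). Policy. $p_k=\sum_{j\in\mathcal S_k}\alpha_jp_{kj}$ is the total capacity allocated to queue $k$. $\mathcal C$ is the set of $p\in\mathbb R^K$ for which there exist $p_{kj}\ge0$ with $\sum_{j\in\mathcal S_k}\alpha_jp_{kj}=p_k$ for all $k$ and $\sum_{k\in\mathcal T_j}p_{kj}\le1$ for all $j$. Fix $\varepsilon_0>0$ with $\nu_k/\mu_k\ge\varepsilon_0$ for all $k$, and let $\mathcal C_{\varepsilon_0}=\{p\in\mathcal C:p_k\ge\varepsilon_0\ \forall k\}$; $[x]_{\mathcal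 C_{\varepsilon_0}}$ is Euclidean projection onto $\mathcal C_{\varepsilon_0}$. $\tilde E^n$ is the $K\times K$ diagonal matrix with $\tilde E^n_{kk}=\mathbf 1_{\{Q^n_k>0\}}$. $(\beta^n)$ is a positive decreasing sequence with $\sum_n\beta^n=\infty$, $\sum_n(\beta^n)^2<\infty$, and $\lim_{n\to\infty}\frac1{n\beta^n}$ existing and finite. The initial vector $p^0\in\mathcal C$ is arbitrary. *)

(* Defs.v *)
From HB Require Import structures.
From mathcomp Require Import all_boot all_order all_algebra.
From mathcomp Require Import all_classical all_reals all_analysis.
Import Order.TTheory GRing.Theory Num.Theory.
Import numFieldNormedType.Exports.

Set Implicit Arguments.
Unset Strict Implicit.
Unset Printing Implicit Defensive.

Local Open Scope classical_set_scope.
Local Open Scope ring_scope.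

Section Network.
Context {R : realType} {K J : nat}.
Implicit Types (S : 'I_K -> {set 'I_J}) (mu : 'I_K -> R) (alpha : 'I_J -> R).
Implicit Types (rt : 'M[R]_K) (lam : 'cV[R]_K) (x : 'M[R]_(K, J)).

Definition served_queues S (j : 'I_J) : {set 'I_K} := [set k | j \in S k].

(* [x k j] is the fraction of server [j] given to queue [k]; the entries with
   [j \notin S k] never enter a sum. *)
Definition feasible S x : Prop :=
  (forall k j, 0 <= x k j) /\
  (forall j, \sum_(k in served_queues S j) x k j <= 1).

Definition service_rate S mu alpha x (k : 'I_K) : R :=
  \sum_(j in S k) mu k * alpha j * x k j.

Definition substochastic rt : Prop :=
  (forall k' k, 0 <= rt k' k) /\ (forall k', \sum_k rt k' k <= 1).

Definition nominal_rates rt lam : 'cV[R]_K := invmx (1%:M - rt^T) *m lam.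

Definition capacity_region S mu alpha rt : set 'cV[R]_K :=
  [set lam : 'cV[R]_K | (forall k, 0 <= lam k 0) /\
     exists x, feasible S x /\
       forall k, nominal_rates rt lam k 0 <= service_rate S mu alpha x k].

Definition allocations S alpha : set 'cV[R]_K :=
  [set p : 'cV[R]_K | exists x, feasible S x /\
     forall k, \sum_(j in S k) alpha j * x k j = p k 0].

Definition allocations_ge S alpha (eps0 : R) : set 'cV[R]_K :=
  [set p : 'cV[R]_K | allocations S alpha p /\ forall k, eps0 <= p k 0].

Definition euclidean_norm (v : 'cV[R]_K) : R :=
  Num.sqrt (\sum_k v k 0 ^+ 2).

Definition is_projection (C : set 'cV[R]_K) (v y : 'cV[R]_K) : Prop :=
  C y /\ forall z, C z -> euclidean_norm (v - y) <= euclidean_norm (v - z).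

Definition nonempty_mx (q : 'I_K -> nat) : 'M[R]_K :=
  diag_mx (\row_k (0 < q k)%N%:R).

Definition increment (q q' : 'I_K -> nat) : 'cV[R]_K :=
  \col_k ((q' k)%:R - (q k)%:R).

End Network.

Section Conditioning.
Context {d : measure_display} {T : measurableType d} {R : realType}.
Variable P : probability T R.

(* [f] is a version of the conditional probability of [B] given [G], for [G] a
   sub-sigma-algebra of the measurable sets. *)
Definition is_cond_prob (G : set_system T) (B : set T) (f : T -> R) : Prop :=
  [/\ g_sigma_algebra_preimage f `<=` G,
      P.-integrable setT (EFin \o f) &
      forall A, G A -> (\int[P]_(w in A) (f w)%:E = P (A `&` B))%E].

(* Mutual conditional independence given [G] of the sigma-algebras [F i]. *)
Definition cond_independent (G : set_system T) (I : finType)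
    (F : I -> set_system T) : Prop :=
  forall (L : {set I}) (B : I -> set T) (f : I -> T -> R),
    (forall i, i \in L -> F i (B i)) ->
    (forall i, i \in L -> is_cond_prob G (B i) (f i)) ->
    is_cond_prob G (\bigcap_(i in [set` L]) B i) (fun w => \prod_(i in L) f i w).

End Conditioning.

Section Process.
Context {d : measure_display} {T : measurableType d} {R : realType} {K : nat}.
Implicit Types (Q : nat -> T -> 'I_K -> nat) (p : nat -> T -> 'cV[R]_K).

(* Sigma-algebra generated by the queue lengths and the allocation vectors at
   times [m <= n]. *)
Definition history Q p (n : nat) : set_system T :=
  <<s \bigcup_(m in [set m | (m <= n)%N]) \bigcup_(k in [set: 'I_K])
        (g_sigma_algebra_preimage (fun w => Q m w k) `|`
         g_sigma_algebra_preimage (fun w => p m w k 0)) >>.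

Definition departure (q : 'I_K -> nat) (s : 'I_K -> bool) (k : 'I_K) : bool :=
  s k && (0 < q k)%N.

(* The equation is over the integers, where the difference is not truncated;
   [r k' k] is the indicator that a task leaving [k'] goes to [k]. *)
Definition queue_step (q q' : 'I_K -> nat) (a s : 'I_K -> bool)
    (r : 'I_K -> 'I_K -> bool) : Prop :=
  forall k, ((q' k)%:Z = (q k)%:Z + (a k)%:Z
    + \sum_(k' < K) (departure q s k' * r k' k)%N%:Z - (departure q s k)%:Z)%R.

(* The primitive random sources at a fixed time: the exogenous arrival to each
   queue, the service attempt at each queue, and the routing decision out of
   each queue, the latter being generated by the whole family [r k' _]. *)
Definition source_sigma (a s : 'I_K -> T -> bool) (r : 'I_K -> 'I_K -> T -> bool)
    (i : 'I_K + 'I_K + 'I_K) : set_system T :=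
  match i with
  | inl (inl k) => g_sigma_algebra_preimage (a k)
  | inl (inr k) => g_sigma_algebra_preimage (s k)
  | inr k' => <<s \bigcup_(k in [set: 'I_K]) g_sigma_algebra_preimage (r k' k) >>
  end.

End Process.

(* Main.v *)
Require Import Defs.
From HB Require Import structures.
From mathcomp Require Import all_boot all_order all_algebra.
From mathcomp Require Import all_classical all_reals all_analysis.
From mathcomp Require Import measurable_realfun ring lra.
Import Order.TTheory GRing.Theory Num.Theory.
Import numFieldNormedType.Exports.

Set Implicit Arguments.
Unset Strict Implicit.
Unset Printing Implicit Defensive.

Local Open Scope classical_set_scope.
Local Open Scope ring_scope.

(* Write [A] for the inverse of [I - R^T], [e_k] for the indicator of
   [Q_k > 0], and [zeta^n = A (Delta Q^(n+1)) - (nu_k - e_k mu_k p_k^n)_k], which is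
   bounded and centered given the history.

   The squared distance [D_n = |p^n - p*|^2] satisfies
   [D_(n+1) <= D_n - 2 beta_n sum_k e_k mu_k (p_k^n - p*_k)^2 + X_n + c beta_n^2]
   with [X_n = 2 beta_n sum_k e_k (p_k^n - p*_k) zeta_k^n]. As [sum_n X_n] converges
   almost surely, [D_n] converges and
   [sum_n beta_n e_k (p_k^n - p*_k)^2 < oo]; since [n beta_n] is bounded below,
   Kronecker's lemma shows that [e_k (p_k^n - p*_k)^2] tends to 0 on average.

   It remains to see that the proportion of idle times vanishes. Let [G_k(n)] be
   the time queue [k] has spent empty. Summing the dynamics,
   [A Q^n = (nu_k G_k(n))_k + o(n)], hence
   [Q_k^n = nu_k G_k(n) - sum_k' r_k'k nu_k' G_k'(n) + o(n)]. The left-hand side is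
   0 whenever [G_k] grows, so that [(I - R^T) (nu_k G_k(n))_k <= o(n)] coordinatewise
   at all times; as [A >= 0], [G_k(n) = o(n)]. So [D_n] tends to 0 on average, and its
   limit is 0. *)

(** * Deterministic lemmas *)

Section SubstochasticInverse.
Context {R : realType} {K : nat}.
Variable rt : 'M[R]_K.
Hypothesis rt_sub : substochastic rt.
Hypothesis rt_open : 1%:M - rt^T \in unitmx.

Lemma open_mulE (x : 'cV[R]_K) k :
  ((1%:M - rt^T) *m x) k 0 = x k 0 - \sum_k' rt k' k * x k' 0.
Proof.
rewrite mulmxBl mul1mx !mxE; congr (_ - _).
by apply: eq_bigr => i _; rewrite !mxE.
Qed.

(* The negative part [y] of [x] satisfies [y <= R^T y]; summing the coordinates
   forces equality, so that [y] lies in the kernel of [I - R^T]. *)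
Lemma open_mul_ge0 (x : 'cV[R]_K) :
  (forall k, 0 <= ((1%:M - rt^T) *m x) k 0) -> forall k, 0 <= x k 0.
Proof.
case: rt_sub => r0 r1 xge0.
pose y : 'cV[R]_K := \col_k Num.max 0 (- x k 0).
have yge0 k : 0 <= y k 0 by rewrite mxE le_max lexx.
have xy k : - x k 0 <= y k 0 by rewrite mxE le_max lexx orbT.
have le1 k : y k 0 <= \sum_k' rt k' k * y k' 0.
  rewrite {1}mxE ge_max sumr_ge0 => [/=|i _]; last exact: mulr_ge0.
  have := xge0 k; rewrite open_mulE subr_ge0 => h.
  rewrite lerNl (le_trans _ h)// -sumrN ler_sum// => i _.
  by rewrite -mulrN ler_wpM2l// lerNl.
have sumle : \sum_k \sum_k' rt k' k * y k' 0 <= \sum_k y k 0.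
  rewrite exchange_big /= ler_sum// => i _.
  by rewrite -mulr_suml ler_piMl.
have eq0 k : y k 0 = \sum_k' rt k' k * y k' 0.
  have ge0 i : true -> 0 <= \sum_k' rt k' i * y k' 0 - y i 0.
    by rewrite subr_ge0.
  apply/eqP; rewrite eq_sym -subr_eq0; apply/eqP.
  apply: (psumr_eq0P (P := predT) ge0) => //; rewrite sumrB.
  apply/eqP; rewrite eq_le subr_le0 sumle/= subr_ge0.
  by apply: ler_sum => i _; exact: le1.
have y0 : y = 0.
  rewrite -(mulKmx rt_open y) (_ : _ *m y = 0) ?mulmx0//.
  by apply/colP => k; rewrite open_mulE -eq0 subrr mxE.
by move=> k; have := xy k; rewrite y0 mxE oppr_le0.
Qed.

(** The matrix [I - R^T] maps column [j] of its inverse to a unit vector, which is nonnegative. *)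
Lemma open_inv_ge0 i j : 0 <= invmx (1%:M - rt^T) i j.
Proof.
have -> : invmx (1%:M - rt^T) i j = col j (invmx (1%:M - rt^T)) i 0.
  by rewrite mxE.
apply: open_mul_ge0 => k.
by rewrite colE mulmxA mulmxV// mul1mx mxE ler0n.
Qed.

Lemma open_inv_mul_ge0 (x : 'cV[R]_K) :
  (forall k, 0 <= x k 0) ->
  forall k, 0 <= (invmx (1%:M - rt^T) *m x) k 0.
Proof.
move=> x0 k; rewrite mxE sumr_ge0// => j _.
by rewrite mulr_ge0// open_inv_ge0.
Qed.

End SubstochasticInverse.

(** * Euclidean projection onto a convex set *)

Section Projection.
Context {R : realType} {K : nat}.
Variable C : set 'cV[R]_K.
Hypothesis C_convex : forall x y t, C x -> C y -> 0 <= t <= 1 ->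
  C (x + t *: (y - x)).

Lemma euclidean_norm_le (u v : 'cV[R]_K) :
  (euclidean_norm u <= euclidean_norm v) =
  (\sum_k u k 0 ^+ 2 <= \sum_k v k 0 ^+ 2).
Proof.
by rewrite /euclidean_norm ler_sqrt// sumr_ge0// => k _; rewrite sqr_ge0.
Qed.

(** Moving from [y] towards [z] by a fraction [t] changes the squared distance to [v] by
    [- 2 t a + t^2 b], which minimality keeps nonnegative for [t] in [[0, 1]]. *)
Lemma projection_obtuse v y z : is_projection C v y -> C z ->
  \sum_k (v k 0 - y k 0) * (z k 0 - y k 0) <= 0.
Proof.
move=> [Cy ymin] Cz; set a := \sum_k _.
pose b := \sum_k (z k 0 - y k 0) ^+ 2.
have b0 : 0 <= b by rewrite sumr_ge0// => k _; rewrite sqr_ge0.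
rewrite leNgt; apply/negP => a0.
have h t : 0 <= t <= 1 -> 0 <= - (2 * t * a) + t ^+ 2 * b.
  move=> t01; have := ymin _ (C_convex Cy Cz t01).
  rewrite euclidean_norm_le -subr_ge0 => /le_trans; apply.
  rewrite le_eqVlt; apply/orP; left; apply/eqP.
  rewrite -sumrB /a /b !mulr_sumr -sumrN -big_split/=; apply: eq_bigr => k _.
  by rewrite !mxE; ring.
have ab0 : 0 < a + b by rewrite ltr_pwDl.
(* For [a > 0] this [t] lies in [[0, 1]] even when [b = 0], and it makes the change negative. *)
have /h : 0 <= a / (a + b) <= 1.
  by rewrite ler_pdivrMr// mul1r lerDl b0 andbT divr_ge0 ?ltW.
have -> : - (2 * (a / (a + b)) * a) + (a / (a + b)) ^+ 2 * b =
          - (a / (a + b)) ^+ 2 * (2 * a + b).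
  by field; rewrite gt_eqF.
rewrite mulNr oppr_ge0 leNgt mulr_gt0// ?exprn_gt0 ?divr_gt0//.
by rewrite ltr_pwDl// mulr_gt0.
Qed.

(** Law of cosines at [y]: the obtuse angle gives the cross term the right sign. *)
Lemma projection_contract v y z : is_projection C v y -> C z ->
  \sum_k (y k 0 - z k 0) ^+ 2 <= \sum_k (v k 0 - z k 0) ^+ 2.
Proof.
move=> yP Cz; have h := projection_obtuse yP Cz.
have -> : \sum_k (v k 0 - z k 0) ^+ 2 = \sum_k (y k 0 - z k 0) ^+ 2
   - 2 * \sum_k (v k 0 - y k 0) * (z k 0 - y k 0)
   + \sum_k (v k 0 - y k 0) ^+ 2.
  rewrite mulr_sumr -sumrB -big_split/=; apply: eq_bigr => k _; ring.
have : 0 <= \sum_k (v k 0 - y k 0) ^+ 2.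
  by rewrite sumr_ge0// => k _; rewrite sqr_ge0.
lra.
Qed.

(** The two obtuse-angle inequalities add up to [|y - z|^2 <= 0]. The update being given as a
    relation, this makes the allocations a function of the queues. *)
Lemma projection_unique v y z :
  is_projection C v y -> is_projection C v z -> y = z.
Proof.
move=> yP zP.
have h1 := projection_obtuse yP zP.1.
have h2 := projection_obtuse zP yP.1.
have h : \sum_k (y k 0 - z k 0) ^+ 2 <= 0.
  apply: le_trans (_ : _ <= \sum_k (v k 0 - y k 0) * (z k 0 - y k 0) +
    \sum_k (v k 0 - z k 0) * (y k 0 - z k 0)) _; last by lra.
  by rewrite -big_split/= ler_sum// => k _; rewrite le_eqVlt; apply/orP; left;
    apply/eqP; ring.
apply/colP => k; apply/eqP; rewrite -subr_eq0 -sqrf_eq0.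
have ge0 i : true -> 0 <= (y i 0 - z i 0) ^+ 2 by rewrite sqr_ge0.
apply/eqP; apply: (psumr_eq0P (P := predT) ge0) => //.
by apply/eqP; rewrite eq_le h sumr_ge0.
Qed.

End Projection.

(** * Sequences negligible against [n] *)

Section Sublinear.
Context {R : realType}.
Implicit Types u v x D : nat -> R.

(** This is [u n = o(n)], with a constant [C] in place of a threshold, so that the bounds hold at
    every [n] and can be added. *)
Definition sublinear u :=
  forall e, 0 < e -> exists C, forall n, `|u n| <= e * n%:R + C.

Lemma sublinear_le u v c : (forall n, `|u n| <= `|v n| + c) ->
  sublinear v -> sublinear u.
Proof.
move=> uv sv e e0; have [C vC] := sv e e0.
exists (C + c) => n; rewrite (le_trans (uv n))// addrA.
by rewrite lerD2r.
Qed.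

Lemma sublinearD u v : sublinear u -> sublinear v ->
  sublinear (fun n => u n + v n).
Proof.
move=> su sv e e0.
have e20 : 0 < e / 2 by rewrite divr_gt0.
have [C uC] := su _ e20; have [C' vC'] := sv _ e20.
exists (C + C') => n; rewrite (le_trans (ler_normD _ _))//.
have := lerD (uC n) (vC' n); lra.
Qed.

Lemma sublinearZ c u : sublinear u -> sublinear (fun n => c * u n).
Proof.
move=> su e e0.
have c0 : 0 < `|c| + 1 by rewrite ltr_wpDl.
have [C uC] := su (e / (`|c| + 1)) (divr_gt0 e0 c0).
exists ((`|c| + 1) * C) => n; rewrite normrM.
apply: le_trans (_ : _ <= (`|c| + 1) * `|u n|) _.
  by rewrite ler_wpM2r// lerDl.
have := ler_wpM2l (ltW c0) (uC n) => /le_trans; apply.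
rewrite le_eqVlt; apply/orP; left; apply/eqP.
by field; rewrite gt_eqF.
Qed.

Lemma sublinear_cst c : sublinear (fun=> c).
Proof. by move=> e e0; exists `|c| => n; rewrite lerDr mulr_ge0// ltW. Qed.

Lemma sublinear_sum (I : finType) (u : I -> nat -> R) :
  (forall i, sublinear (u i)) -> sublinear (fun n => \sum_i u i n).
Proof.
move=> su; elim: (index_enum I) => [|i s ih].
  under eq_fun do rewrite big_nil; exact: sublinear_cst.
under eq_fun do rewrite big_cons; exact: sublinearD.
Qed.

Lemma sublinear_near u : (forall e, 0 < e -> \forall n \near \oo, `|u n| <= e * n%:R) ->
  sublinear u.
Proof.
move=> su e e0; have [N _ uN] := su e e0.
(* The constant absorbs the terms before the threshold [N]. *)
exists (\sum_(m < N) `|u m|) => n.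
have [nN|Nn] := ltnP n N.
  rewrite (bigD1 (Ordinal nN))//= addrCA lerDl addr_ge0//.
    by rewrite mulr_ge0// ltW.
  by rewrite sumr_ge0.
by rewrite (le_trans (uN n Nn))// lerDl sumr_ge0.
Qed.

(** Cesaro averaging: each term from [N] on costs at most [e], and the earlier ones form the
    constant. *)
Lemma sublinear_series_cvg0 t : t @ \oo --> 0 -> sublinear (series t).
Proof.
move=> t0 e e0.
have [N _ tN] : \forall n \near \oo, `|t n| <= e.
  by move/cvgrPdist_le : t0 => /(_ e e0); under eq_near do rewrite sub0r normrN.
exists (\sum_(m < N) `|t m|) => n.
rewrite seriesEnat (le_trans (ler_norm_sum _ _ _))//.
have [nN|Nn] := leqP n N.
  rewrite -(big_mkord xpredT (fun m => `|t m|)) [in leRHS](big_cat_nat (n := n))//=.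
  by rewrite addrCA lerDl addr_ge0 ?sumr_ge0// mulr_ge0// ltW.
rewrite -(big_mkord xpredT (fun m => `|t m|)) [in leLHS](big_cat_nat (n := N))//= ?(ltnW Nn)//.
rewrite addrC lerD2r; apply: le_trans (_ : \sum_(N <= i < n) e <= _).
  by rewrite big_nat [leRHS]big_nat ler_sum// => i /andP[Ni _]; exact: tN.
by rewrite sumr_const_nat -[leLHS]mulr_natr ler_wpM2l ?ler_nat ?leq_subr// ltW.
Qed.

(* With [s n] the partial sums of [x m / (m + 1)], the partial sums of [x] are
   [\sum_(m < n) (s n - s m)]. *)
Lemma kronecker x : cvgn (series (fun m => x m / m.+1%:R)) ->
  sublinear (series x).
Proof.
set s := series _ => cs; pose t n := s n - limn s.
have t0 : t @ \oo --> 0 by apply/subr_cvg0.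
have xE n : series x n = n%:R * t n + - 1 * series t n.
  elim: n => [|n ih]; first by rewrite /series/= !big_geq// mul0r mulr0 addr0.
  rewrite !seriesSr ih /t (_ : s n.+1 = s n + x n / n.+1%:R); last by rewrite /s seriesSr.
  rewrite -natr1; field; rewrite natr1 pnatr_eq0//.
rewrite (_ : series x = fun n => n%:R * t n + - 1 * series t n); last exact/funext.
apply: sublinearD; last exact/sublinearZ/sublinear_series_cvg0.
apply: sublinear_near => e e0; move/cvgrPdist_le : t0 => /(_ e e0).
apply: filterS => n; rewrite sub0r normrN => h.
by rewrite normrM ger0_norm// mulrC ler_wpM2r.
Qed.

(** The product [n L] is the sum of [D] minus the sum of [D - L]; the latter is [o(n)] by Cesaro
    averaging. *)
Lemma sublinear_series_lim0 D L : (forall n, 0 <= D n) ->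
  D @ \oo --> L -> sublinear (series D) -> L = 0.
Proof.
move=> D0 DL sD.
have L0 : 0 <= L.
  by rewrite -(cvg_lim _ DL)//; apply: limr_ge; [apply/cvg_ex; exists L|exact: nearW].
apply/eqP; rewrite eq_le L0 andbT leNgt; apply/negP => Lgt0.
have sL : sublinear (fun n => n%:R * L).
  have sDL : sublinear (series (fun n => D n - L)).
    by apply: sublinear_series_cvg0; exact/subr_cvg0.
  have -> : (fun n => n%:R * L) = fun n => series D n + - 1 * series (fun n => D n - L) n.
    apply/funext => n; rewrite !seriesEnat/= sumrB sumr_const_nat subn0.
    by rewrite -mulr_natl; ring.
  by apply: sublinearD => //; exact: sublinearZ.
have L20 : 0 < L / 2 by rewrite divr_gt0.
have [C hC] := sL _ L20.
(* This index exceeds [2 C / L], against [n L <= (L / 2) n + C]. *)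
have := hC (Num.truncn (C / (L / 2))).+1.
have := truncnS_gt (C / (L / 2)); rewrite ltr_pdivrMr//.
set n := _.+1%:R; rewrite ger0_norm ?mulr_ge0//.
lra.
Qed.

(** The sum of the weighted inequalities [x <= w + x^2 / w]. *)
Lemma le_series_sqr x (w : R) : (forall n, 0 <= x n) -> 0 < w ->
  forall n, series x n <= w * n%:R + w^-1 * series (fun n => x n ^+ 2) n.
Proof.
move=> x0 w0 n; elim: n => [|n ih].
  by rewrite /series/= !big_geq// !mulr0 addr0.
rewrite !seriesSr.
have : x n <= w + w^-1 * x n ^+ 2.
  have -> : w + w^-1 * x n ^+ 2 = x n + w^-1 * ((w - x n / 2) ^+ 2 + 3 / 4 * x n ^+ 2).
    by field; rewrite gt_eqF.
  rewrite lerDl mulr_ge0//; first by rewrite invr_ge0 ltW.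
  by rewrite addr_ge0 ?sqr_ge0// mulr_ge0 ?sqr_ge0// divr_ge0.
move: ih; rewrite -natr1; lra.
Qed.

(** The preceding bound with [w = e / 2] replaces Cauchy-Schwarz by an additive estimate, which
    suits [sublinear]. *)
Lemma sublinear_series_sqr x : sublinear (series (fun n => x n ^+ 2)) ->
  sublinear (series x).
Proof.
move=> sx e e0.
have e20 : 0 < e / 2 by rewrite divr_gt0.
(* The rate [(e / 2)^2] becomes [e / 2] after division by [w]; the other half of [e] is [w]
   itself. *)
have [C hC] := sx _ (mulr_gt0 e20 e20).
exists ((e / 2)^-1 * C) => n.
rewrite seriesEnat (le_trans (ler_norm_sum _ _ _))//.
have h := @le_series_sqr (fun n => `|x n|) _ (fun n => normr_ge0 _) e20 n.
rewrite (le_trans h)//.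
have {}hC : series (fun n => `|x n| ^+ 2) n <= e / 2 * (e / 2) * n%:R + C.
  apply: le_trans (hC n); under [X in series X]eq_fun do rewrite real_normK ?num_real//.
  exact: ler_norm.
have i0 : 0 <= (e / 2)^-1 by rewrite invr_ge0 ltW.
have := ler_wpM2l i0 hC.
have -> : (e / 2)^-1 * (e / 2 * (e / 2) * n%:R + C) = e / 2 * n%:R + (e / 2)^-1 * C.
  by field; rewrite gt_eqF.
lra.
Qed.

End Sublinear.

(** * Almost decreasing sequences *)

Section Lyapunov.
Context {R : realType}.

(** Pathwise Robbins-Siegmund argument: [D - series c] is nonincreasing and bounded below, and
    telescoping bounds the sums of [U]. The errors [c] may have either sign, so that martingale
    increments fit in. *)
Lemma lyapunov_cvg (D U c : nat -> R) :
  (forall n, 0 <= D n) -> (forall n, 0 <= U n) -> cvgn (series c) ->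
  (forall n, D n.+1 <= D n - U n + c n) ->
  cvgn D /\ cvgn (series U).
Proof.
move=> D0 U0 cc DUc.
have [B [_ sB]] := cvg_seq_bounded cc.
have {}sB n : `|series c n| <= B + 1 by apply: sB => //; rewrite ltrDl.
have bnd n : D n + series U n <= D 0%N + series c n.
  elim: n => [|n ih]; first by rewrite /series/= !big_geq// !addr0.
  rewrite !seriesSr; have := DUc n; lra.
split; last first.
  apply: nondecreasing_is_cvgn.
    by apply/nondecreasing_seqP => n; rewrite seriesSr lerDl.
  exists (D 0%N + (B + 1)) => _ [n _ <-].
  by have := bnd n; have := D0 n; have := sB n; rewrite ler_norml => /andP[]; lra.
have -> : D = fun n => (D n - series c n) + series c n.
  by apply/funext => n; rewrite subrK.
apply: is_cvgD => //; apply: nonincreasing_is_cvgn.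
  by apply/nonincreasing_seqP => n; rewrite seriesSr; have := DUc n; have := U0 n; lra.
exists (- (B + 1)) => _ [n _ <-].
by have := D0 n; have := sB n; rewrite ler_norml => /andP[]; lra.
Qed.

End Lyapunov.

(** * Convergence along a path *)

Section Path.
Context {R : realType} {K : nat}.
Variables (mu : 'I_K -> R) (lam : 'cV[R]_K) (rt : 'M[R]_K).
Hypothesis mu_gt0 : forall k, 0 < mu k.
Hypothesis rt_sub : substochastic rt.
Hypothesis rt_open : 1%:M - rt^T \in unitmx.
Local Notation nu := (nominal_rates rt lam).
Local Notation A := (invmx (1%:M - rt^T)).
Hypothesis nu_gt0 : forall k, 0 < nu k 0.

Definition busy (q : 'I_K -> nat) (k : 'I_K) : R := (0 < q k)%N%:R.

(** The conditional mean of [A (Delta Q)] given the history: [A] cancels the routing, so that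
    coordinate [k] involves the service of queue [k] alone. *)
Definition drift (q : 'I_K -> nat) (x : 'cV[R]_K) : 'cV[R]_K :=
  \col_k (nu k 0 - busy q k * (mu k * x k 0)).

Definition noise (q q' : 'I_K -> nat) (x : 'cV[R]_K) : 'cV[R]_K :=
  A *m increment q q' - drift q x.

Definition optimum : 'cV[R]_K := \col_k (nu k 0 / mu k).

Lemma busy01 q k : busy q k = 0 \/ busy q k = 1.
Proof. by rewrite /busy; case: ltnP; [right|left]. Qed.

(** As [nu_k] is [mu_k] times the optimum, a busy queue feels a linear force towards it. *)
Lemma drift_optimum q x k : busy q k * drift q x k 0 =
  - (busy q k * mu k * (x k 0 - optimum k 0)).
Proof.
rewrite !mxE; case: (busy01 q k) => ->; first by rewrite !mul0r oppr0.
by field; rewrite gt_eqF.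
Qed.

Lemma noiseE q q' x k :
  noise q q' x k 0 = (A *m increment q q') k 0 - drift q x k 0.
Proof. by rewrite /noise mxE [X in _ + X]mxE. Qed.

Lemma nonempty_mxE q (v : 'cV[R]_K) k : (nonempty_mx q *m v) k 0 = busy q k * v k 0.
Proof. by rewrite /nonempty_mx mul_diag_mx !mxE. Qed.

Variables (C : set 'cV[R]_K) (B : R).
Hypothesis C_convex : forall x y t, C x -> C y -> 0 <= t <= 1 ->
  C (x + t *: (y - x)).
Hypothesis C_optimum : C optimum.
Variable beta : nat -> R.
Hypothesis beta_gt0 : forall n, 0 < beta n.
Hypothesis beta_sq_sum : cvgn (series (fun n => beta n ^+ 2)).
Variable c : R.
Hypothesis beta_ge : forall n, n.+1%:R^-1 <= c * beta n.
Variables (q : nat -> 'I_K -> nat) (x : nat -> 'cV[R]_K).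

Local Notation zeta n := (noise (q n) (q n.+1) (x n)).
Local Notation gap n k := (x n k 0 - optimum k 0).

Hypothesis zeta_le : forall n k, `|zeta n k 0| <= B.
Hypothesis gap_le : forall n k, `|gap n k| <= B.
Hypothesis x_step : forall n, is_projection C
  (x n + beta n *: (nonempty_mx (q n) *m A *m increment (q n) (q n.+1))) (x n.+1).
Hypothesis cvg_lyapunov_noise : cvgn (series (fun n =>
  beta n * \sum_k busy (q n) k * gap n k * zeta n k 0)).
Hypothesis cvg_noise : forall k, cvgn (series (fun n => zeta n k 0 / n.+1%:R)).

(** * Decrease of the squared distance to the optimum *)

Let D n := \sum_k gap n k ^+ 2.
Let U n := \sum_k busy (q n) k * mu k * gap n k ^+ 2.

(** The projection does not move away from [optimum], which lies in [C], so it is enough to expand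
    the square before projecting. The cross term yields [U] and the noise; the second-order term is
    bounded through [B]. *)
Lemma lyapunov_step n : D n.+1 <= D n - 2 * (beta n * U n) +
  (2 * (beta n * \sum_k busy (q n) k * gap n k * zeta n k 0) +
   \sum_k (B + mu k * B) ^+ 2 * beta n ^+ 2).
Proof.
have := projection_contract C_convex (x_step n) C_optimum.
move=> /le_trans; apply.
rewrite /D /U !mulr_sumr -sumrB -!big_split/= ler_sum// => k _.
set w := beta n.
have -> : (x n + w *: (nonempty_mx (q n) *m A *m increment (q n) (q n.+1))) k 0
   = x n k 0 + w * (busy (q n) k * (zeta n k 0 - mu k * gap n k)).
  rewrite mxE [X in _ + X]mxE -mulmxA nonempty_mxE; congr (_ + _ * _).
  rewrite noiseE !mulrBr drift_optimum; ring.
set g := gap n k; set z := zeta n k 0; set b := busy _ _.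
have -> : x n k 0 + w * (b * (z - mu k * g)) - optimum k 0 = g + w * (b * (z - mu k * g)).
  by rewrite /g; ring.
have B0 : 0 <= B by exact: le_trans (normr_ge0 _) (zeta_le n k).
have zg : (b * (z - mu k * g)) ^+ 2 <= (B + mu k * B) ^+ 2.
  have muB : 0 <= mu k * B by rewrite mulr_ge0// ltW.
  rewrite -[leLHS]real_normK ?num_real// ler_sqr ?nnegrE ?addr_ge0//.
  rewrite normrM; apply: le_trans (_ : `|z - mu k * g| <= _).
    by rewrite ler_piMl// /b; case: (busy01 (q n) k) => ->; rewrite ?normr0 ?normr1.
  rewrite (le_trans (ler_normB _ _))// lerD//; first exact: zeta_le.
  by rewrite normrM gtr0_norm// ler_wpM2l ?(ltW (mu_gt0 k))//; exact: gap_le.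
have := ler_wpM2r (sqr_ge0 w) zg.
have -> : (g + w * (b * (z - mu k * g))) ^+ 2 = g ^+ 2 - 2 * (w * (b * mu k * g ^+ 2))
   + (2 * (w * (b * g * z)) + (b * (z - mu k * g)) ^+ 2 * w ^+ 2) by ring.
lra.
Qed.

Lemma lyapunov_converges :
  cvgn D /\ cvgn (series (fun n => 2 * (beta n * U n))).
Proof.
apply: (@lyapunov_cvg _ _ _ (fun n =>
  2 * (beta n * \sum_k busy (q n) k * gap n k * zeta n k 0) +
  \sum_k (B + mu k * B) ^+ 2 * beta n ^+ 2)); last exact: lyapunov_step.
- by move=> n; rewrite sumr_ge0// => k _; rewrite sqr_ge0.
- move=> n; rewrite mulr_ge0// mulr_ge0 ?(ltW (beta_gt0 n))// sumr_ge0// => k _.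
  by rewrite mulr_ge0 ?sqr_ge0// mulr_ge0 ?ler0n// ltW.
- rewrite (_ : (fun n => _) = 2 *: (fun n =>
      beta n * \sum_k busy (q n) k * gap n k * zeta n k 0) +
    (\sum_k (B + mu k * B) ^+ 2) *: (fun n => beta n ^+ 2)); last first.
    by apply/funext => n; rewrite -mulr_suml.
  by apply: is_cvg_seriesD; exact: is_cvg_seriesZ.
Qed.

(** Kronecker's lemma asks for a convergent series with weights [1 / (n + 1)]; these are at most
    [c * beta n], and the series of [beta n * U n] converges. *)
Lemma sublinear_busy_gap_sqr k :
  sublinear (series (fun n => busy (q n) k * gap n k ^+ 2)).
Proof.
apply: kronecker; have [_ cU] := lyapunov_converges.
have c_gt0 : 0 < c.
  rewrite -(pmulr_lgt0 _ (beta_gt0 0)); apply: lt_le_trans (beta_ge 0).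
  by rewrite invr_gt0.
have cm0 : 0 <= c / mu k by rewrite divr_ge0// ltW.
have U0 n k' : 0 <= busy (q n) k' * mu k' * gap n k' ^+ 2.
  by rewrite mulr_ge0 ?sqr_ge0// mulr_ge0 ?ler0n// ltW.
(* The factor [c] exchanges the weights, and [1 / mu k] removes the rate contained in [U]. *)
apply: (@series_le_cvg _ _ ((c / mu k) *: (fun n => 2 * (beta n * U n)))).
- by move=> n; rewrite divr_ge0// mulr_ge0 ?sqr_ge0// ler0n.
- move=> n; rewrite !fctE mulr_ge0// mulr_ge0//.
  by rewrite mulr_ge0 ?sumr_ge0// ltW.
- move=> n; rewrite !fctE.
  apply: le_trans (_ : busy (q n) k * gap n k ^+ 2 * (c * beta n) <= _).
    by rewrite ler_wpM2l// mulr_ge0 ?sqr_ge0// ler0n.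
  apply: le_trans (_ : c / mu k * (beta n * (busy (q n) k * mu k * gap n k ^+ 2)) <= _).
    by rewrite le_eqVlt; apply/orP; left; apply/eqP; field; rewrite gt_eqF.
  rewrite ler_wpM2l//.
  have tU : busy (q n) k * mu k * gap n k ^+ 2 <= U n.
    by rewrite /U (bigD1 k)//= lerDl sumr_ge0.
  have := ler_wpM2l (ltW (beta_gt0 n)) tU.
  have : 0 <= beta n * U n by rewrite mulr_ge0 ?sumr_ge0// ltW.
  lra.
- exact: is_cvg_seriesZ.
Qed.

(** * Flow balance and idle times *)

Definition idle_time k := series (fun n => 1 - busy (q n) k).

Lemma idle_time_ge0 k n : 0 <= idle_time k n.
Proof.
rewrite /idle_time seriesEnat sumr_ge0// => m _.
by case: (busy01 (q m) k) => ->; rewrite ?subrr ?subr0.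
Qed.

(** The part of [A Q^n] that will be [o(n)]: initial queues, accumulated noise, and accumulated
    deviation of the allocation at busy times. *)
Let rest : nat -> 'cV[R]_K := fun n => \col_k ((A *m \col_j (q 0%N j)%:R) k 0
  + (series (fun m => zeta m k 0) n
     - mu k * series (fun m => busy (q m) k * gap m k) n)).

Let idle : nat -> 'cV[R]_K := fun n => \col_k (nu k 0 * idle_time k n).

Let idleE n k : idle n k 0 = nu k 0 * idle_time k n.
Proof. by rewrite mxE. Qed.

(** One step adds [zeta] plus [drift], and [drift] splits into [nu_k] at idle times and [- mu_k]
    times the gap at busy times. *)
Lemma queue_idle_rest n : A *m (\col_j (q n j)%:R) = idle n + rest n.
Proof.
apply/colP => k; rewrite [RHS]mxE idleE [rest n k 0]mxE /idle_time.
elim: n => [|n ih]; first by rewrite /series/= !big_geq// !mulr0 subr0 addr0 add0r.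
rewrite (_ : \col_j (q n.+1 j)%:R = \col_j (q n j)%:R + increment (q n) (q n.+1));
  last by apply/colP => j; rewrite !mxE addrC subrK.
rewrite mulmxDr mxE ih !seriesSr.
have -> : (A *m increment (q n) (q n.+1)) k 0 = zeta n k 0 + drift (q n) (x n) k 0.
  by rewrite noiseE subrK.
rewrite [drift _ _ k 0]mxE [optimum k 0]mxE; field; rewrite gt_eqF//.
Qed.

Lemma sublinear_busy_gap k : sublinear (series (fun n => busy (q n) k * gap n k)).
Proof.
apply: sublinear_series_sqr.
(* The indicator equals its square. *)
rewrite (_ : (fun n => _) = fun n => busy (q n) k * gap n k ^+ 2).
  exact: sublinear_busy_gap_sqr.
by apply/funext => n; case: (busy01 (q n) k) => ->; ring.
Qed.

Lemma sublinear_rest k : sublinear (fun n => rest n k 0).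
Proof.
under eq_fun do rewrite mxE.
apply: sublinearD; first exact: sublinear_cst.
apply: sublinearD; first exact: kronecker.
under eq_fun do rewrite -mulNr.
exact/sublinearZ/sublinear_busy_gap.
Qed.

(** The error in [Q^n] itself: applying [I - R^T] to the balance gives [Q^n = (I - R^T) idle n + (I
    - R^T) rest n]. *)
Let open_rest n k := ((1%:M - rt^T) *m rest n) k 0.

Lemma sublinear_open_rest k : sublinear (open_rest^~ k).
Proof.
rewrite /open_rest; under eq_fun do rewrite open_mulE.
apply: sublinearD; first exact: sublinear_rest.
under eq_fun do rewrite -sumrN.
apply: sublinear_sum => i.
under eq_fun do rewrite -mulNr.
exact/sublinearZ/sublinear_rest.
Qed.

(* [idle_time k] only grows when queue [k] is empty; at such times the flow
   balance bounds it by the idle time of the other queues. *)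
Lemma sublinear_open_idle k :
  sublinear (fun n => Num.max 0 (((1%:M - rt^T) *m idle n) k 0)).
Proof.
move=> e e0; have [c0 hc] := sublinear_open_rest k e0.
have c00 : 0 <= c0 by have := hc 0%N; rewrite mulr0 add0r; exact: le_trans.
(* Here [c0] bounds the error at an empty time, and [nu k 0] pays for the unit that [idle_time k]
   gains in the following step. *)
exists (c0 + nu k 0) => n.
have bnd_ge0 m : 0 <= e * m%:R + (c0 + nu k 0).
  by rewrite addr_ge0 ?mulr_ge0 ?addr_ge0// ltW.
rewrite ger0_norm ?le_max ?lexx// ge_max bnd_ge0/=.
have rt0 := rt_sub.1.
elim: n => [|n ih].
  rewrite open_mulE idleE /idle_time {1}/series/= big_geq// mulr0 sub0r.
  apply: le_trans (bnd_ge0 0%N); rewrite oppr_le0 sumr_ge0// => i _.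
  by rewrite mulr_ge0// idleE mulr_ge0 ?idle_time_ge0// ltW.
have mono : \sum_i rt i k * idle n i 0 <= \sum_i rt i k * idle n.+1 i 0.
  rewrite ler_sum// => i _; rewrite ler_wpM2l// !idleE ler_wpM2l ?(ltW (nu_gt0 _))//.
  rewrite /idle_time seriesSr lerDl.
  by case: (busy01 (q n) i) => ->; rewrite ?subrr ?subr0.
rewrite open_mulE idleE /idle_time seriesSr.
rewrite open_mulE idleE in ih.
(* At an empty time the balance with [Q_k = 0] gives the bound afresh; at a busy time [idle_time k]
   is unchanged and the bound at [n] carries over. *)
move: ih; rewrite -/(idle_time k) /busy; case: (posnP (q n k)) => [q0 _|_]/=.
  have : (\col_j (q n j)%:R : 'cV[R]_K) k 0 = 0 by rewrite mxE q0.
  rewrite -[\col_j _](mulKVmx rt_open) queue_idle_rest mulmxDr mxE -/(open_rest n k).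
  rewrite open_mulE idleE.
  have := hc n; rewrite ler_norml => /andP[+ _].
  rewrite -natr1; lra.
rewrite -natr1; lra.
Qed.

(** The positive part [w] of [(I - R^T) idle] is [o(n)]; since [A] has nonnegative entries,
    [idle <= A w]. *)
Lemma sublinear_idle_time k : sublinear (idle_time k).
Proof.
pose w n : 'cV[R]_K := \col_k Num.max 0 (((1%:M - rt^T) *m idle n) k 0).
suff s : sublinear (fun n => (A *m w n) k 0).
  rewrite (_ : idle_time k = fun n => (nu k 0)^-1 * (nu k 0 * idle_time k n)); last first.
    by apply/funext => n; rewrite mulKf// gt_eqF.
  apply: sublinearZ; apply: (sublinear_le (c := 0)) s => n; rewrite addr0.
  have nui : 0 <= nu k 0 * idle_time k n by rewrite mulr_ge0 ?idle_time_ge0// ltW.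
  rewrite (ger0_norm nui); apply: le_trans (ler_norm _).
  have -> : nu k 0 * idle_time k n = (A *m ((1%:M - rt^T) *m idle n)) k 0.
    by rewrite mulKmx// idleE.
  rewrite -subr_ge0.
  have -> : (A *m w n) k 0 - (A *m ((1%:M - rt^T) *m idle n)) k 0 =
    (A *m (w n - (1%:M - rt^T) *m idle n)) k 0.
    by rewrite mulmxBr [RHS]mxE [X in _ = _ + X]mxE.
  apply: open_inv_mul_ge0 => // j; rewrite mxE [X in _ + X]mxE [w n j 0]mxE.
  by rewrite subr_ge0 le_max lexx orbT.
under eq_fun do rewrite mxE.
apply: sublinear_sum => j; under eq_fun do rewrite mxE.
exact/sublinearZ/sublinear_open_idle.
Qed.

(** Idle times contribute at most [B^2] each, and they are [o(n)] in number. *)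
Lemma sublinear_gap_sqr k : sublinear (series (fun n => gap n k ^+ 2)).
Proof.
have s : sublinear (fun n => series (fun n => busy (q n) k * gap n k ^+ 2) n
   + B ^+ 2 * idle_time k n).
  by apply: sublinearD; [exact: sublinear_busy_gap_sqr|
    exact/sublinearZ/sublinear_idle_time].
apply: (sublinear_le (c := 0)) s => n; rewrite addr0.
rewrite ger0_norm; last first.
  by rewrite seriesEnat sumr_ge0// => i _; rewrite sqr_ge0.
apply: le_trans (ler_norm _).
rewrite /idle_time !seriesEnat/= mulr_sumr -big_split/= ler_sum// => m _.
have gB : gap m k ^+ 2 <= B ^+ 2.
  rewrite -[leLHS]real_normK ?num_real// ler_sqr ?nnegrE//.
  exact: le_trans (normr_ge0 _) (gap_le m k).
case: (busy01 (q m) k) => ->; first by rewrite mul0r add0r subr0 mulr1.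
by rewrite mul1r subrr mulr0 addr0.
Qed.

Lemma path_cvg : x @ \oo --> optimum.
Proof.
have [/cvg_ex[L DL] _] := lyapunov_converges.
have D0 n : 0 <= D n by rewrite sumr_ge0// => k _; rewrite sqr_ge0.
have L0 : L = 0.
  apply: (sublinear_series_lim0 D0 DL).
  rewrite (_ : series D = fun n => \sum_k series (fun m => gap m k ^+ 2) n).
    by apply: sublinear_sum => k; exact: sublinear_gap_sqr.
  by apply/funext => n; rewrite seriesEnat /D exchange_big.
rewrite {}L0 in DL.
(* Balls of column vectors are coordinatewise, and each squared gap is at most [D n]. *)
apply/cvg_ballP => e e0.
have Dlt : \forall n \near \oo, D n < e ^+ 2.
  by apply: (cvgr_lt (0 : R) DL); rewrite exprn_gt0.
apply: filterS Dlt => n Dn; split => // i j; rewrite (ord1 j).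
rewrite /ball/= distrC -ltr_sqr ?nnegrE ?(ltW e0)// real_normK ?num_real//.
apply: le_lt_trans Dn; rewrite /D (bigD1 i)//= lerDl.
by rewrite sumr_ge0// => k _; rewrite sqr_ge0.
Qed.

End Path.

(** * Martingales with finitely many values *)

Section FiniteValued.
Context {d : measure_display} {T : measurableType d} {R : realType}.
Variable P : probability T R.
Context {F : finType}.
Variable f : T -> F.
Hypothesis f_meas : forall c, measurable (f @^-1` [set c]).

(** For [f] with finitely many values, this stands for measurability with respect to the
    sigma-algebra of [f]. *)
Definition determined {V : Type} (g : T -> V) := forall w w', f w = f w' -> g w = g w'.

Lemma determined_factor (V : pointedType) (g : T -> V) : determined g ->
  exists h : F -> V, forall w, g w = h (f w).
Proof.
(* The default [point] is taken on the codes that [f] never attains. *)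
move=> gf; exists (fun c => xget point (g @` (f @^-1` [set c]))) => w.
have : (g @` (f @^-1` [set f w])) (g w) by exists w.
by case: xgetP => [y _ [w' /= ww' <-] _|/(_ (g w))//]; exact: gf.
Qed.

(** The preimage is a finite union of fibers of [f]. *)
Lemma determined_preimage V (g : T -> V) (B : set V) : determined g ->
  measurable (g @^-1` B).
Proof.
move=> gf.
rewrite (_ : g @^-1` B = \bigcup_(c in f @` (g @^-1` B)) f @^-1` [set c]).
  exact: fin_bigcup_measurable.
apply/seteqP; split=> [w Bw|w [_ [w' /= Bw' <-] /= ww']].
  by exists (f w) => //; exists w.
by rewrite /= (gf _ _ ww').
Qed.

Lemma determined_bounded (g : T -> R) : determined g ->
  exists2 M, 0 <= M & forall w, `|g w| <= M.
Proof.
move=> /determined_factor[h gh]; exists (\sum_c `|h c|); first exact: sumr_ge0.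
by move=> w; rewrite gh (bigD1 (f w))//= lerDl sumr_ge0.
Qed.

Lemma determined_measurable D (g : T -> R) : determined g -> measurable_fun D g.
Proof.
move=> gf; apply: (@measurable_funS _ _ _ _ setT) => // _ B mB.
by rewrite setTI; exact: determined_preimage.
Qed.

Lemma determined_integrable D (g : T -> R) : measurable D -> determined g ->
  P.-integrable D (EFin \o g).
Proof.
move=> mD gf; apply: measurable_bounded_integrable => //.
- by rewrite (le_lt_trans (probability_le1 P mD))// ltry.
- exact: determined_measurable.
- have [M M0 gM] := determined_bounded gf.
  by exists M; split => [|y My w _ /=]; [exact: num_real|exact: le_trans (gM w) (ltW My)].
Qed.

Lemma Rintegral_sum (I : finType) (g : I -> T -> R) :
  (forall i, P.-integrable setT (EFin \o g i)) ->
  \int[P]_w (\sum_i g i w) = \sum_i \int[P]_w g i w.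
Proof.
move=> gi; elim: (index_enum I) => [|i s ih].
  by rewrite big_nil; under eq_Rintegral do rewrite big_nil;
    rewrite Rintegral_cst// mul0r.
rewrite big_cons -ih -RintegralD//.
  by apply: eq_Rintegral => w _; rewrite big_cons.
rewrite (_ : _ \o _ = fun w => (\sum_(j <- s) (g j w)%:E)%E).
  by apply: integrable_sum => //= j _; exact: gi.
by apply/funext => w; rewrite /= sumEFin.
Qed.

(** Zero conditional expectation given [f], tested on the fibers, which generate its sigma-algebra;
    no division by their probability occurs. *)
Definition centered (X : T -> R) :=
  forall c, \int[P]_(w in f @^-1` [set c]) X w = 0.

(** On each fiber [g] is constant and [X] integrates to 0. This is the orthogonality of martingale
    increments. *)
Lemma centered_mul (X g : T -> R) : P.-integrable setT (EFin \o X) ->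
  centered X -> determined g -> \int[P]_w (g w * X w) = 0.
Proof.
move=> Xi X0 /determined_factor[h gh].
have Xci c : P.-integrable setT (EFin \o (X \_ (f @^-1` [set c]))).
  rewrite -restrict_EFin; apply/(integrable_mkcond _ (f_meas c)).
  exact: (integrableS measurableT (f_meas c)) Xi.
have -> : \int[P]_w (g w * X w) =
    \int[P]_w (\sum_c h c * (X \_ (f @^-1` [set c])) w).
  apply: eq_Rintegral => w _; rewrite gh (bigD1 (f w))//= big1 ?addr0 => [|c cf].
    by rewrite patchE ifT// inE.
  by rewrite patchE ifF ?mulr0//; apply/negP; rewrite inE/= => /esym/eqP; exact/negP.
rewrite Rintegral_sum => [|c]; last first.
  rewrite (_ : _ \o _ = (fun w => (h c)%:E * (EFin \o (X \_ (f @^-1` [set c]))) w)%E).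
    exact: integrableZl.
  by apply/funext => w; rewrite /= EFinM.
by rewrite big1// => c _; rewrite RintegralZl// -Rintegral_mkcond X0 mulr0.
Qed.

End FiniteValued.

(** * Martingale convergence along a refining sequence of finite codes *)

Section Martingale.
Context {d : measure_display} {T : measurableType d} {R : realType}.
Variable P : probability T R.
Variables (F : nat -> finType) (f : forall n, T -> F n).
Hypothesis f_meas : forall n c, measurable (f n @^-1` [set c]).
Hypothesis f_refine : forall n w w', f n.+1 w = f n.+1 w' -> f n w = f n w'.

Lemma determinedS V (g : T -> V) n : determined (f n) g -> determined (f n.+1) g.
Proof. by move=> gf w w' /f_refine; exact: gf. Qed.

Section Kolmogorov.
Variables (X : nat -> T -> R) (b : nat -> R).
Hypothesis X_det : forall n, determined (f n.+1) (X n).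
Hypothesis X_centered : forall n, centered P (f n) (X n).
Hypothesis X_le : forall n w, `|X n w| <= b n.

Let S n w := series (X^~ w) n.

Lemma partial_sum_determined n : determined (f n) (S n).
Proof.
elim: n => [|n ih] w w' ww'; first by rewrite /S /series/= !big_geq.
by rewrite /S !seriesSr (X_det ww') -/(S n w) (ih _ _ (f_refine ww')).
Qed.

Variable e : R.
Hypothesis e_gt0 : 0 < e.

(** The stopping rule for the first exit from [(-e, e)]; it is decided by the code at time [n],
    hence a predictable weight for [X n]. *)
Fixpoint inside n w : bool := (`|S n w| < e) && (if n is m.+1 then inside m w else true).

Lemma inside_determined n : determined (f n) (inside n).
Proof.
elim: n => [|n ih] w w' ww' /=; rewrite (partial_sum_determined ww')//.
by rewrite (ih _ _ (f_refine ww')).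
Qed.

Lemma insideP n w : reflect (forall k, (k <= n)%N -> `|S k w| < e) (inside n w).
Proof.
elim: n => [|n ih] /=.
  rewrite andbT; apply: (iffP idP) => [h k|]; last exact.
  by rewrite leqn0 => /eqP ->.
apply: (iffP andP) => [[h /ih h'] k|h]; last first.
  by split; [exact: h|apply/ih => k kn; exact/h/leqW].
by rewrite leq_eqVlt => /predU1P[->//|]; rewrite ltnS => /h'.
Qed.

Let X' n w := (inside n w)%:R * X n w.
Let S' n w := series (X'^~ w) n.

Lemma stopped_determined n : determined (f n) (S' n).
Proof.
elim: n => [|n ih] w w' ww'; first by rewrite /S' /series/= !big_geq.
rewrite /S' !seriesSr -/(S' n w) (ih _ _ (f_refine ww')) /X' (X_det ww').
by rewrite (inside_determined (f_refine ww')).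
Qed.

(** From the first exit on, the stopped sum stays frozen at its exit value. *)
Lemma stopped_sum n w : if inside n w then S' n w = S n w else e <= `|S' n w|.
Proof.
elim: n => [|n ih] /=.
  by rewrite /S' /S /series/= !big_geq// normr0 e_gt0.
rewrite /S' seriesSr -/(S' n w) /X'; move: ih; case: (inside n w) => ih.
  rewrite andbT ih mul1r (_ : S n w + X n w = S n.+1 w); last first.
    by rewrite /S seriesSr.
  by case: ltP.
by rewrite andbF mul0r addr0.
Qed.

(** The cross term vanishes, its weight being known at time [n], and the square of each stopped
    increment is at most [b n ^+ 2]. *)
Lemma stopped_sum_sqr n : \int[P]_w (S' n w ^+ 2) <= \sum_(0 <= m < n) b m ^+ 2.
Proof.
elim: n => [|n ih].
  rewrite big_geq//; under eq_Rintegral do rewrite /S' /series/= big_geq// expr0n.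
  by rewrite Rintegral_cst// mul0r.
have dX' : determined (f n.+1) (X' n).
  move=> w w' ww'; rewrite /X' (X_det ww').
  by rewrite (inside_determined (f_refine ww')).
have dS' : determined (f n.+1) (S' n) := determinedS (@stopped_determined n).
have int g : determined (f n.+1) g -> P.-integrable setT (EFin \o g).
  exact: determined_integrable.
have i1 : P.-integrable setT (EFin \o (fun w => S' n w ^+ 2)).
  by apply: int => w w' ww'; rewrite (dS' _ _ ww').
have i2 : P.-integrable setT (EFin \o
    (fun w => (2 * S' n w * (inside n w)%:R) * X n w)).
  apply: int => w w' ww'.
  by rewrite (dS' _ _ ww') (X_det ww') (inside_determined (f_refine ww')).
have i3 : P.-integrable setT (EFin \o (fun w => X' n w ^+ 2)).
  by apply: int => w w' ww'; rewrite (dX' _ _ ww').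
have -> : \int[P]_w (S' n.+1 w ^+ 2) = \int[P]_w (S' n w ^+ 2) +
   \int[P]_w ((2 * S' n w * (inside n w)%:R) * X n w) + \int[P]_w (X' n w ^+ 2).
  rewrite -[X in X + _]RintegralD// -RintegralD//.
    apply: eq_Rintegral => w _; rewrite /S' seriesSr -/(S' n w) /X'; ring.
  by rewrite (_ : _ \o _ = (fun w => (S' n w ^+ 2)%:E +
    (2 * S' n w * (inside n w)%:R * X n w)%:E)%E)//; exact: integrableD.
rewrite (centered_mul (f_meas (n:=n)) _ (@X_centered n)); last 2 first.
- by apply: int; exact: X_det.
- move=> w w' ww'.
  by rewrite (stopped_determined ww') (inside_determined ww').
rewrite addr0 big_nat_recr//= lerD//.
apply: le_trans (_ : \int[P]_w (cst (b n ^+ 2) w) <= _).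
  apply: le_Rintegral => //.
  - by apply: int.
  move=> w _; rewrite /X' exprMn -[leRHS]mul1r ler_pM ?sqr_ge0//.
    by case: inside; rewrite ?expr1n ?expr0n.
  rewrite -[leLHS]real_normK ?num_real// ler_sqr ?nnegrE//.
  exact: le_trans (normr_ge0 _) (X_le n w).
rewrite Rintegral_cst// (_ : fine _ = 1) ?mulr1//.
exact: (congr1 fine (probability_setT P)).
Qed.

Lemma excursionE n :
  [set w | exists2 k, (k <= n)%N & e <= `|S k w|] = inside n @^-1` [set false].
Proof.
apply/seteqP; split=> [w [k kn ek]|w /= /negbT].
  by apply/negbTE/negP => /insideP/(_ _ kn); rewrite ltNge ek.
by apply: contraNP => h; apply/insideP => k kn; rewrite ltNge; apply/negP => ek;
  apply: h; exists k.
Qed.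

Lemma excursion_measurable n :
  measurable [set w | exists2 k, (k <= n)%N & e <= `|S k w|].
Proof.
rewrite excursionE.
exact: (determined_preimage (f_meas (n:=n)) _ (inside_determined (n:=n))).
Qed.

(* The partial sums stopped at the first exit from [(-e, e)] are still those of
   centered increments, so that Chebyshev's inequality applies to them. *)
Lemma kolmogorov_inequality n :
  (P [set w | exists2 k, (k <= n)%N & (e <= `|S k w|)%R] <=
   (e ^- 2 * \sum_(0 <= m < n) b m ^+ 2)%R%:E)%E.
Proof.
have mB := excursion_measurable n; rewrite excursionE in mB *.
rewrite -[leLHS]fineK ?fin_num_measure// lee_fin.
rewrite mulrC ler_pdivlMr ?exprn_gt0//.
apply: le_trans (stopped_sum_sqr n).
rewrite mulrC -Rintegral_cst// Rintegral_mkcond.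
have dS2 : determined (f n) (fun w => S' n w ^+ 2).
  by move=> w w' ww'; rewrite (stopped_determined ww').
apply: le_Rintegral => //.
- rewrite -restrict_EFin; apply/(integrable_mkcond _ mB).
  exact: (determined_integrable P (f_meas (n:=n))).
- exact: (determined_integrable P (f_meas (n:=n))).
move=> w _; rewrite patchE; case: ifPn => [|_]; last exact: sqr_ge0.
rewrite inE/= => wi; have := stopped_sum n w; rewrite wi => eS.
by rewrite -[leRHS]real_normK ?num_real// ler_sqr ?nnegrE// ltW.
Qed.

End Kolmogorov.

(** Kolmogorov's inequality for the increments from time [N] on bounds the probability of a later
    move of size [1 / (j + 1)] by [(j + 1)^2] times [tail N], which tends to 0. Almost surely the
    partial sums are therefore Cauchy. *)
Theorem martingale_cvg (X : nat -> T -> R) (b : nat -> R) :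
  (forall n, determined (f n.+1) (X n)) ->
  (forall n, centered P (f n) (X n)) ->
  (forall n w, `|X n w| <= b n) ->
  cvgn (series (fun n => b n ^+ 2)) ->
  {ae P, forall w, cvgn (series (X^~ w))}.
Proof.
move=> X_det X_centered X_le cb.
(* Zeroing the increments before [N], rather than shifting the index, keeps the same codes. *)
pose Y N n w := (N <= n)%N%:R * X n w.
have Y_det N n : determined (f n.+1) (Y N n).
  by move=> w w' ww'; rewrite /Y (X_det _ _ _ ww').
have Y_centered N n : centered P (f n) (Y N n).
  move=> c; rewrite /Y RintegralZl//; first by rewrite X_centered mulr0.
  by apply: (determined_integrable P (f_meas (n:=n.+1))).
have Y_le N n w : `|Y N n w| <= (N <= n)%N%:R * b n.
  by rewrite /Y normrM normr_nat ler_wpM2l.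
have YX N n w : (N <= n)%N -> series (Y N ^~ w) n = series (X ^~ w) n - series (X ^~ w) N.
  move=> Nn; rewrite sub_series_geq// seriesEnat/= (big_cat_nat (n := N))//=.
  rewrite big_nat big1 ?add0r => [|i /andP[_ iN]]; last first.
    by rewrite /Y leqNgt iN mul0r.
  by rewrite big_nat [RHS]big_nat; apply: eq_bigr => i /andP[Ni _]; rewrite /Y Ni mul1r.
pose tail N := limn (series (fun n => b n ^+ 2)) - series (fun n => b n ^+ 2) N.
have tail0 : tail @ \oo --> 0.
  by rewrite -(subrr (limn (series (fun n => b n ^+ 2)))); apply: cvgB => //; exact: cvg_cst.
have b_tail N n : \sum_(0 <= m < n) ((N <= m)%N%:R * b m) ^+ 2 <= tail N.
  have nd : nondecreasing_seq (series (fun n => b n ^+ 2)).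
    by apply/nondecreasing_seqP => k; rewrite seriesSr lerDl sqr_ge0.
  have [nN|Nn] := leqP n N.
    rewrite big_nat big1 => [|m /andP[_ mn]]; last first.
      by rewrite leqNgt (leq_trans mn nN) mul0r expr0n.
    by rewrite subr_ge0; exact: nondecreasing_cvgn_le.
  rewrite (big_cat_nat (n := N)) ?(ltnW Nn)//= big_nat big1 ?add0r; last first.
    by move=> m /andP[_ mN]; rewrite leqNgt mN mul0r expr0n.
  rewrite big_nat; under eq_bigr => m /andP[Nm _] do rewrite Nm mul1r.
  rewrite -big_nat -(sub_series_geq (fun n => b n ^+ 2) (ltnW Nn)) lerD2r.
  exact: nondecreasing_cvgn_le.
pose E j N M := [set w | exists2 k, (k <= M)%N & j.+1%:R^-1 <= `|series (Y N ^~ w) k|].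
have mE j N M : measurable (E j N M).
  by apply: excursion_measurable => //; exact: Y_det.
have mUE j N : measurable (\bigcup_M E j N M) by exact: bigcupT_measurable.
(* The points where every starting time [N] is followed by an excursion of size [1 / (j + 1)]. *)
pose A j := \bigcap_N \bigcup_M E j N M.
have mA j : measurable (A j) by exact: bigcapT_measurable.
have PUE j N : (P (\bigcup_M E j N M) <= (j.+1%:R^-1 ^- 2 * tail N)%:E)%E.
  have ndE : nondecreasing_seq (E j N).
    move=> m n mn; apply/subsetPset => w [k km ek].
    by exists k => //; exact: leq_trans mn.
  (* Continuity from below in [M] reduces the bound to finite horizons. *)
  apply: (cvge_to_le (nondecreasing_cvg_mu (mE j N) (mUE j N) ndE)).
  apply: nearW => M; apply: le_trans (_ : _ <= (j.+1%:R^-1 ^- 2 *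
    \sum_(0 <= m < M) ((N <= m)%N%:R * b m) ^+ 2)%:E)%E _.
    by apply: (kolmogorov_inequality (Y_det N)).
  by rewrite lee_fin ler_wpM2l// invr_ge0 exprn_ge0.
have PA j : P (A j) = 0%E.
  apply/eqP; rewrite -measure_le0 -[leLHS]fineK ?fin_num_measure// lee_fin.
  have t0 : (fun N => j.+1%:R^-1 ^- 2 * tail N) @ \oo --> 0.
    by rewrite -[X in _ --> X](mulr0 (j.+1%:R^-1 ^- 2)); apply: cvgMr.
  apply: (cvgr_to_ge t0); apply: nearW => N.
  rewrite -lee_fin fineK ?fin_num_measure//; apply: le_trans (PUE j N).
  by rewrite le_measure ?inE//; exact: bigcap_inf.
apply: (@negligibleS _ _ _ _ (\bigcup_j A j)).
  move=> w /=; apply: contra_notP => wA.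
  apply/cauchy_cvgP/cauchy_exP => e e0.
  pose j := Num.truncn e^-1.
  have je : j.+1%:R^-1 < e.
    by rewrite invf_plt ?posrE//; exact: truncnS_gt.
  have [N wN] : exists N, ~ (\bigcup_M E j N M) w.
    apply: contrapT => h; apply: wA; exists j => // N _.
    by apply: contrapT => hN; apply: h; exists N.
  exists (series (X ^~ w) N), N => // n /= Nn.
  rewrite /ball/= distrC -(YX N n w Nn); apply: lt_trans je.
  rewrite ltNge; apply/negP => h; apply: wN; exists n => //.
  by exists n.
by apply: negligible_bigcup => j; apply/negligibleP; [exact: mA|exact: PA].
Qed.

End Martingale.

(** * The queueing process *)

Section Allocations.
Context {R : realType} {K J : nat}.
Variables (S : 'I_K -> {set 'I_J}) (mu : 'I_K -> R) (alpha : 'I_J -> R).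
Hypothesis mu_gt0 : forall k, 0 < mu k.
Hypothesis alpha_gt0 : forall j, 0 < alpha j.

Lemma allocations_ge_convex eps0 (x y : 'cV[R]_K) (t : R) :
  allocations_ge S alpha eps0 x -> allocations_ge S alpha eps0 y -> 0 <= t <= 1 ->
  allocations_ge S alpha eps0 (x + t *: (y - x)).
Proof.
move=> [[u [[u0 u1] ux]] xe] [[v [[v0 v1] vy]] ye] /andP[t0 t1].
have s0 : 0 <= 1 - t by rewrite subr_ge0.
have cE (a b : R) : a + t * (b - a) = (1 - t) * a + t * b by ring.
split; last first.
  move=> k; rewrite !mxE cE.
  have := lerD (ler_wpM2l s0 (xe k)) (ler_wpM2l t0 (ye k)); lra.
exists (\matrix_(k, j) ((1 - t) * u k j + t * v k j)); split; first split.
- by move=> k j; rewrite mxE addr_ge0// mulr_ge0.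
- move=> j; under eq_bigr do rewrite mxE.
  rewrite big_split/= -!mulr_sumr.
  have := lerD (ler_wpM2l s0 (u1 j)) (ler_wpM2l t0 (v1 j)); lra.
- move=> k; rewrite !mxE cE -ux -vy !mulr_sumr -big_split/=.
  by apply: eq_bigr => j _; rewrite mxE; ring.
Qed.

Lemma allocations_ge0 (x : 'cV[R]_K) k : allocations S alpha x -> 0 <= x k 0.
Proof.
by move=> [u [[u0 _] <-]]; rewrite sumr_ge0// => j _; rewrite mulr_ge0// ltW.
Qed.

Lemma allocations_le (x : 'cV[R]_K) k :
  (forall (x : 'M[R]_(K, J)) (k : 'I_K),
     feasible S x -> service_rate S mu alpha x k < 1) ->
  allocations S alpha x -> mu k * x k 0 <= 1.
Proof.
move=> rate_lt1 [u [uf <-]]; apply/ltW.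
apply: le_lt_trans (rate_lt1 u k uf); rewrite mulr_sumr /service_rate.
by under eq_bigr do rewrite mulrA.
Qed.

(** A witness of [lam] in the capacity region gives each queue at least the required capacity;
    scaling row [k] by [w k <= 1] makes it exact and keeps the servers feasible. *)
Lemma optimum_allocations lam rt eps0 :
  (forall k, 0 < nominal_rates rt lam k 0) ->
  capacity_region S mu alpha rt lam ->
  (forall k, eps0 <= nominal_rates rt lam k 0 / mu k) ->
  allocations_ge S alpha eps0 (optimum mu lam rt).
Proof.
move=> nu0 [_ [u [[u0 u1] nuu]]] epsle; split; last by move=> k; rewrite mxE.
pose c k := \sum_(j in S k) alpha j * u k j.
have nuc k : nominal_rates rt lam k 0 <= mu k * c k.
  apply: le_trans (nuu k) _; rewrite mulr_sumr.
  by under [leRHS]eq_bigr do rewrite mulrA.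
have c0 k : 0 < c k by rewrite -(pmulr_rgt0 _ (mu_gt0 k)) (lt_le_trans (nu0 k)).
pose w k := nominal_rates rt lam k 0 / mu k / c k.
have w0 k : 0 <= w k by rewrite !divr_ge0// ltW.
have w1 k : w k <= 1 by rewrite !ler_pdivrMr// mul1r mulrC.
exists (\matrix_(k, j) (w k * u k j)); split; first split.
- by move=> k j; rewrite mxE mulr_ge0.
- move=> j; apply: le_trans (u1 j); apply: ler_sum => k _.
  by rewrite mxE ler_piMl.
- move=> k; rewrite mxE; under eq_bigr do rewrite mxE mulrCA.
  by rewrite -mulr_sumr divfK// gt_eqF.
Qed.

End Allocations.

(** * Variables with zero conditional mean given a finite code *)

Section ConditionallyNull.
Context {d : measure_display} {T : measurableType d} {R : realType}.
Variable P : probability T R.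
Context {F : finType}.
Variable f : T -> F.
Hypothesis f_meas : forall c, measurable (f @^-1` [set c]).

Definition cond_null (X : T -> R) :=
  P.-integrable setT (EFin \o X) /\ centered P f X.

Let integrable_fiber X c : P.-integrable setT (EFin \o X) ->
  P.-integrable (f @^-1` [set c]) (EFin \o X).
Proof. by apply: integrableS. Qed.

Lemma cond_nullD X Y : cond_null X -> cond_null Y ->
  cond_null (fun w => X w + Y w).
Proof.
move=> [Xi X0] [Yi Y0]; split.
  rewrite (_ : _ \o _ = (fun w => (X w)%:E + (Y w)%:E)%E)//.
  exact: integrableD.
by move=> c; rewrite RintegralD ?X0 ?Y0 ?addr0//; exact: integrable_fiber.
Qed.

Lemma cond_null0 : cond_null (fun=> 0).
Proof.
split; first by apply: determined_integrable.
by move=> c; rewrite Rintegral_cst// mul0r.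
Qed.

Lemma cond_null_sum (I : finType) (X : I -> T -> R) : (forall i, cond_null (X i)) ->
  cond_null (fun w => \sum_i X i w).
Proof.
move=> Xn; elim: (index_enum I) => [|i s ih].
  by under eq_fun do rewrite big_nil; exact: cond_null0.
by under eq_fun do rewrite big_cons; exact: cond_nullD.
Qed.

Lemma cond_null_mul g X : determined f g -> cond_null X ->
  cond_null (fun w => g w * X w).
Proof.
move=> gf [Xi X0]; split.
  have [M M0 gM] := determined_bounded gf.
  rewrite (_ : _ \o _ = ((EFin \o g) \* (EFin \o X))%E)//.
  apply: integrableMr => //; first exact: determined_measurable.
  by exists M; split => [|y My w _ /=]; [exact: num_real|exact: le_trans (gM w) (ltW My)].
(* On a nonempty fiber [g] is the constant [g w0]; an empty fiber contributes 0. *)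
move=> c; have [[w0 fw0]|nw] := pselect (exists w0, f w0 = c).
  rewrite -(mulr0 (g w0)) -(X0 c) -RintegralZl//; last exact: integrable_fiber.
  by apply: eq_Rintegral => w; rewrite inE/= => fw; rewrite (gf w w0)// fw fw0.
rewrite (_ : _ @^-1` _ = set0) ?Rintegral_set0//.
by apply/seteqP; split => // w /= fw; apply: nw; exists w.
Qed.

Lemma cond_nullZ c X : cond_null X -> cond_null (fun w => c * X w).
Proof. exact: cond_null_mul. Qed.

(** Passage from conditional probabilities given [G] to the finite code: the fibers lie in [G], so
    the defining identity can be tested on them. *)
Lemma is_cond_prob_null (G : set_system T) B g :
  (forall c, G (f @^-1` [set c])) -> measurable B -> is_cond_prob P G B g ->
  cond_null (fun w => \1_B w - g w).
Proof.
move=> fG mB [_ gi gB].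
have Bi : P.-integrable setT (EFin \o (\1_B : T -> R)).
  apply: measurable_bounded_integrable => //.
  - by rewrite (le_lt_trans (probability_le1 P measurableT))// ltry.
  - exists 1; split => [|y y1 w _ /=]; first exact: num_real.
    by rewrite indicE ger0_norm ?ler0n// (le_trans _ (ltW y1))// lern1 leq_b1.
split.
  rewrite (_ : _ \o _ = (fun w => (\1_B w)%:E - (g w)%:E)%E)//.
  exact: integrableB.
move=> c; rewrite RintegralB//; try exact: integrable_fiber.
by rewrite /Rintegral integral_indic// gB// setIC subrr.
Qed.

End ConditionallyNull.

(* The initial state being deterministic, the queue lengths up to time [n] take
   finitely many values and determine the allocations: a finite code of the
   path of [Q] carries the whole history. *)
Section PathCode.
Context {T : Type} {K : nat}.
Variables (Q : nat -> T -> 'I_K -> nat) (L : nat -> nat).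
Hypothesis Q_le : forall m n w k, (m <= n)%N -> (Q m w k <= L n)%N.

Definition path_code n (w : T) : {ffun 'I_n.+1 -> {ffun 'I_K -> 'I_(L n).+1}} :=
  [ffun m : 'I_n.+1 => [ffun k => inord (Q m w k)]].

Lemma path_codeP n w w' :
  path_code n w = path_code n w' <-> forall m, (m <= n)%N -> Q m w = Q m w'.
Proof.
split=> [ww' m mn|ww']; last first.
  by apply/ffunP => m; apply/ffunP => k; rewrite !ffunE ww'// -ltnS.
apply/funext => k.
move/ffunP : ww' => /(_ (Ordinal (mn : m < n.+1)%N))/ffunP/(_ k).
rewrite !ffunE/= => /(congr1 val) /=.
(* The bound [Q_le] excludes the default value of [inord], so the code is faithful. *)
by rewrite !inordK// ltnS Q_le.
Qed.

End PathCode.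

(** The measurable structure is left arbitrary, to serve for the ambient sigma-algebra and for the
    history alike. *)
Lemma path_code_measurable {d} {T : measurableType d} {K : nat}
    (Q : nat -> T -> 'I_K -> nat) (L : nat -> nat) n :
  (forall m k B, (m <= n)%N -> measurable ((fun w => Q m w k) @^-1` B)) ->
  forall c, measurable (path_code Q L n @^-1` [set c]).
Proof.
move=> mQ c.
rewrite (_ : _ @^-1` _ = \bigcap_(m in [set: 'I_n.+1]) \bigcap_(k in [set: 'I_K])
    ((fun w => Q m w k) @^-1` [set v | inord v = c m k])).
  apply: fin_bigcap_measurable => // m _; apply: fin_bigcap_measurable => // k _.
  by apply: mQ; rewrite -ltnS.
apply/seteqP; split=> [w /= <- m _ k _ /=|w h /=]; first by rewrite !ffunE.
by apply/ffunP => m; apply/ffunP => k; rewrite !ffunE; exact: h.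
Qed.

Section Process.
Context (R : realType) (K J : nat).
Variables (S : 'I_K -> {set 'I_J}) (mu : 'I_K -> R) (alpha : 'I_J -> R).
Variables (lam : 'cV[R]_K) (rt : 'M[R]_K).
Hypothesis mu_gt0 : forall k, 0 < mu k.
Hypothesis alpha_gt0 : forall j, 0 < alpha j.
Hypothesis rate_lt1 : forall (x : 'M[R]_(K, J)) (k : 'I_K),
  feasible S x -> service_rate S mu alpha x k < 1.
Hypothesis rt_open : 1%:M - rt^T \in unitmx.
Variable eps0 : R.
Variable beta : nat -> R.
Context (d : measure_display) (T : measurableType d).
Variable P : probability T R.
Variables (Q : nat -> T -> 'I_K -> nat) (p : nat -> T -> 'cV[R]_K).
Variables (a s : nat -> 'I_K -> {RV P >-> bool}).
Variable r : nat -> 'I_K -> 'I_K -> {RV P >-> bool}.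
Variable q0 : 'I_K -> nat.
Hypothesis Q_init : forall w, Q 0%N w = q0.
Variable p0 : 'cV[R]_K.
Hypothesis p0_alloc : allocations S alpha p0.
Hypothesis p_init : forall w, p 0%N w = p0.
Hypothesis Q_step : forall n w,
  queue_step (Q n w) (Q n.+1 w) (fun k => a n k w) (fun k => s n k w)
    (fun k' k => r n k' k w).
Hypothesis p_step : forall n w,
  is_projection (allocations_ge S alpha eps0)
    (p n w + beta n *: (nonempty_mx (Q n w) *m invmx (1%:M - rt^T)
                          *m increment (Q n w) (Q n.+1 w)))
    (p n.+1 w).
Hypothesis sources_indep : forall n,
  cond_independent P (history Q p n)
    (source_sigma (fun k => a n k : T -> bool) (fun k => s n k : T -> bool)
       (fun k' k => r n k' k : T -> bool)).
Hypothesis a_law : forall n k,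
  is_cond_prob P (history Q p n) (a n k @^-1` [set true]) (fun=> lam k 0).
Hypothesis s_law : forall n k,
  is_cond_prob P (history Q p n) (s n k @^-1` [set true])
    (fun w => mu k * p n w k 0).
Hypothesis r_law : forall n k' k,
  is_cond_prob P (history Q p n) (r n k' k @^-1` [set true]) (fun=> rt k' k).

Local Notation nu := (nominal_rates rt lam).
Local Notation A := (invmx (1%:M - rt^T)).
Local Notation busy := (@busy R K).

(** * Queues and allocations as functions of the finite code *)

Lemma increment_sources n w k :
  increment (Q n w) (Q n.+1 w) k 0 = (a n k w)%:R
    + \sum_k' busy (Q n w) k' * ((s n k' w)%:R * (r n k' k w)%:R)
    - busy (Q n w) k * (s n k w)%:R :> R.
Proof.
rewrite mxE; have := congr1 (fun z : int => z%:~R : R) (Q_step n w k).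
rewrite rmorphB !rmorphD/= rmorph_sum/= -!pmulrn => ->.
rewrite [LHS]addrC !addrA addNr add0r; congr (_ + _ - _); last first.
  by rewrite /departure /busy; case: (s n k w); case: ltnP; rewrite /= ?mulr1 ?mulr0.
apply: eq_bigr => k' _; rewrite -pmulrn /departure /busy.
by case: (s n k' w); case: (r n k' k w); case: ltnP; rewrite /= ?(mulr1, mulr0).
Qed.

(** One arrival, at most [K] transfers and one departure. *)
Lemma increment_le n w k : `|increment (Q n w) (Q n.+1 w) k 0| <= K.+2%:R :> R.
Proof.
rewrite increment_sources.
have b01 (b : bool) : `|b%:R| <= 1 :> R by case: b; rewrite ?normr1 ?normr0.
have busy1 q k' : `|busy q k'| <= 1 := b01 _.
have m1 (x y : R) : `|x| <= 1 -> `|y| <= 1 -> `|x * y| <= 1.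
  by move=> x1 y1; rewrite normrM mulr_ile1.
rewrite -[K.+2%:R]natr1 -[K.+1%:R]nat1r (le_trans (ler_normB _ _))//.
rewrite lerD ?m1// (le_trans (ler_normD _ _))// lerD//.
rewrite (le_trans (ler_norm_sum _ _ _))//.
apply: le_trans (_ : \sum_(i < K) 1 <= _); last by rewrite sumr_const card_ord.
by apply: ler_sum => i _; rewrite !m1.
Qed.

(** The total initial content bounds each initial queue, and each step adds at most [K + 2]. *)
Let L n := (\sum_k q0 k + n * K.+2)%N.

Lemma queue_le m n w k : (m <= n)%N -> (Q m w k <= L n)%N.
Proof.
move=> mn; apply: (@leq_trans (L m)); last by rewrite leq_add2l leq_mul2r mn orbT.
elim: m {mn} => [|m ih]; first by rewrite Q_init /L mul0n addn0 (bigD1 k)//= leq_addr.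
have := increment_le m w k; rewrite mxE => /(le_trans (ler_norm _)).
rewrite lerBlDl -natrD ler_nat => /leq_trans; apply.
by rewrite /L mulSn addnCA addnC leq_add2l.
Qed.

Local Notation code := (path_code Q L).

Let codeP n w w' := @path_codeP T K Q L queue_le n w w'.

Lemma path_code_refine n w w' : code n.+1 w = code n.+1 w' -> code n w = code n w'.
Proof. by move=> /codeP h; apply/codeP => m mn; apply: h; exact: leqW. Qed.

Lemma queue_determined n : determined (code n) (Q n).
Proof. by move=> w w' /codeP; exact. Qed.

(** By induction, equal queue paths give equal points to project, and the projection onto a convex
    set is unique. *)
Lemma allocation_determined n : determined (code n) (p n).
Proof.
elim: n => [|n ih] w w' ww'; first by rewrite !p_init.
have := p_step n w; rewrite (ih _ _ (path_code_refine ww')).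
rewrite (queue_determined (path_code_refine ww')) (queue_determined ww') => h.
apply: projection_unique h (p_step n w').
exact: allocations_ge_convex.
Qed.

Lemma allocation_feasible n w : allocations S alpha (p n w).
Proof. by case: n => [|n]; [rewrite p_init|case: (p_step n w) => -[]]. Qed.

Let bool_measurable (b : {RV P >-> bool}) B : measurable ((b : T -> bool) @^-1` B).
Proof. by rewrite -[X in measurable X]setTI; exact: measurable_funP. Qed.

(** The recursion transports measurability from the sources. It is read in [R], where sums and
    products of measurable functions are available, and brought back by a countable union. *)
Lemma queue_measurable n k B : measurable ((fun w => Q n w k) @^-1` B).
Proof.
elim: n k B => [|n ih] k B.
  under eq_fun do rewrite Q_init.
  have [Bk|nBk] := pselect (B (q0 k)).
    by rewrite (_ : _ @^-1` _ = setT)//; apply/seteqP; split.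
  by rewrite (_ : _ @^-1` _ = set0)//; apply/seteqP; split.
have mb (b : {RV P >-> bool}) : measurable_fun setT (fun w => (b w)%:R : R).
  by move=> _ Y _; rewrite setTI; exact: (bool_measurable b [set x | Y x%:R]).
have mq (g : nat -> R) j : measurable_fun setT (fun w => g (Q n w j)).
  by move=> _ Y _; rewrite setTI; exact: (ih j (g @^-1` Y)).
have mh : measurable_fun setT (fun w => (Q n.+1 w k)%:R : R).
  have -> : (fun w => (Q n.+1 w k)%:R : R) = fun w => (Q n w k)%:R + ((a n k w)%:R
    + \sum_k' busy (Q n w) k' * ((s n k' w)%:R * (r n k' k w)%:R)
    - busy (Q n w) k * (s n k w)%:R).
    by apply/funext => w; rewrite -increment_sources mxE addrC subrK.
  apply: measurable_funD; first exact: (mq (fun v => v%:R)).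
  apply: measurable_funB.
    apply: measurable_funD => //; apply: measurable_sum => k'.
    apply: measurable_funM; first exact: (mq (fun v => (0 < v)%N%:R)).
    exact: measurable_funM.
  by apply: measurable_funM => //; exact: (mq (fun v => (0 < v)%N%:R)).
rewrite (_ : _ @^-1` _ = \bigcup_(v in B)
    ((fun w => (Q n.+1 w k)%:R : R) @^-1` [set v%:R])).
  by apply: bigcup_measurable => v _; rewrite -[X in measurable X]setTI; exact: mh.
apply/seteqP; split=> [w Bw|w [v Bv /= /eqP]]; first by exists (Q n.+1 w k).
by rewrite eqr_nat => /eqP ->.
Qed.

Lemma code_measurable n c : measurable (code n @^-1` [set c]).
Proof. by apply: path_code_measurable => m k B _; exact: queue_measurable. Qed.

Lemma code_history n c : history Q p n (code n @^-1` [set c]).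
Proof.
(* Here [T] carries the history as its sigma-algebra. *)
apply: (@path_code_measurable _ (g_sigma_algebraType
  (\bigcup_(m in [set m | (m <= n)%N]) \bigcup_(k in [set: 'I_K])
        (g_sigma_algebra_preimage (fun w => Q m w k) `|`
         g_sigma_algebra_preimage (fun w => p m w k 0)))) K Q L n) => m k B mn.
apply: sub_sigma_algebra; exists m => //; exists k => //; left.
by exists B => //; rewrite setTI.
Qed.

(** * Centering of the sources and of the noise *)

Let boolE (b : {RV P >-> bool}) w : \1_((b : T -> bool) @^-1` [set true]) w = (b w)%:R :> R.
Proof.
by rewrite indicE; congr ((nat_of_bool _)%:R); apply/idP/idP; rewrite inE.
Qed.

Lemma arrival_cond_null n k :
  cond_null P (code n) (fun w => (a n k w)%:R - lam k 0).
Proof.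
have := is_cond_prob_null (code_measurable (n:=n)) (@code_history n)
  (bool_measurable (a n k) _) (a_law n k).
by under eq_fun do rewrite boolE.
Qed.

Lemma service_cond_null n k :
  cond_null P (code n) (fun w => (s n k w)%:R - mu k * p n w k 0).
Proof.
have := is_cond_prob_null (code_measurable (n:=n)) (@code_history n)
  (bool_measurable (s n k) _) (s_law n k).
by under eq_fun do rewrite boolE.
Qed.

(** Conditional independence enters here, for the service attempt at [k'] and the routing out of
    [k']. *)
Lemma transfer_cond_prob n k' k :
  is_cond_prob P (history Q p n)
    (s n k' @^-1` [set true] `&` r n k' k @^-1` [set true])
    (fun w => mu k' * p n w k' 0 * rt k' k).
Proof.
pose i1 : 'I_K + 'I_K + 'I_K := inl (inr k').
pose i2 : 'I_K + 'I_K + 'I_K := inr k'.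
pose B (i : 'I_K + 'I_K + 'I_K) : set T :=
  if i == i1 then s n k' @^-1` [set true] else r n k' k @^-1` [set true].
pose g (i : 'I_K + 'I_K + 'I_K) (w : T) : R :=
  if i == i1 then mu k' * p n w k' 0 else rt k' k.
have := @sources_indep n [set i1; i2]%SET B g.
have -> : \bigcap_(i in [set` [set i1; i2]%SET]) B i =
    s n k' @^-1` [set true] `&` r n k' k @^-1` [set true].
  apply/seteqP; split=> [w h|w [h1 h2] i].
    split.
      suff : B i1 w by rewrite /B eqxx.
      by apply: h; rewrite /= !inE eqxx.
    suff : B i2 w by [].
    by apply: h; rewrite /= !inE eqxx orbT.
  by rewrite /= !inE => /orP[]/eqP ->; rewrite /B ?eqxx.
have -> : (fun w => \prod_(i in [set i1; i2]%SET) g i w) =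
    (fun w => mu k' * p n w k' 0 * rt k' k).
  by apply/funext => w; rewrite big_setU1 ?inE//= big_set1 /g eqxx.
apply=> i; rewrite !inE => /orP[]/eqP ->; rewrite /B /g ?eqxx.
- by exists [set true] => //; rewrite setTI.
- apply: sub_sigma_algebra; exists k => //.
  by exists [set true] => //; rewrite setTI.
- exact: s_law.
- exact: r_law.
Qed.

Lemma transfer_cond_null n k' k :
  cond_null P (code n) (fun w => (s n k' w)%:R * (r n k' k w)%:R
     - mu k' * p n w k' 0 * rt k' k).
Proof.
have := is_cond_prob_null (code_measurable (n:=n)) (@code_history n)
  (measurableI _ _ (bool_measurable (s n k') _) (bool_measurable (r n k' k) _))
  (transfer_cond_prob n k' k).
by under eq_fun do rewrite indicI/= !boolE.
Qed.

Local Notation zeta n w := (noise mu lam rt (Q n w) (Q n.+1 w) (p n w)).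

(** The increment of queue [j] with each source, or product of sources, replaced by its deviation
    from the conditional mean. *)
Let centered_increment n w j : R := (a n j w)%:R - lam j 0
  + \sum_k' busy (Q n w) k' *
      ((s n k' w)%:R * (r n k' j w)%:R - mu k' * p n w k' 0 * rt k' j)
  + - busy (Q n w) j * ((s n j w)%:R - mu j * p n w j 0).

(** With [v] the vector of effective service rates, [A lam = nu] and [A (I - R^T) v = v] turn
    [drift] into [A] applied to the mean increment. *)
Lemma noise_sum n w k :
  zeta n w k 0 = \sum_j A k j * centered_increment n w j.
Proof.
pose v : 'cV[R]_K := \col_k' (busy (Q n w) k' * (mu k' * p n w k' 0)).
have driftE : drift mu lam rt (Q n w) (p n w) = A *m (lam - (1%:M - rt^T) *m v).
  rewrite mulmxBr mulKmx//; apply/colP => i.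
  by rewrite [LHS]mxE [RHS]mxE; congr (_ + _); rewrite !mxE.
rewrite /noise driftE -mulmxBr mxE; apply: eq_bigr => j _; congr (_ * _).
rewrite mxE increment_sources [X in _ + X]mxE [X in _ - X]mxE [X in _ - (_ + X)]mxE.
rewrite open_mulE [v j 0]mxE /centered_increment.
under [X in _ = _ + X + _]eq_bigr do rewrite mulrBr.
rewrite sumrB.
have -> : \sum_k' rt k' j * v k' 0 =
    \sum_k' busy (Q n w) k' * (mu k' * p n w k' 0 * rt k' j).
  by apply: eq_bigr => k' _; rewrite mxE; ring.
ring.
Qed.

Lemma busy_determined n k : determined (code n) (fun w => busy (Q n w) k).
Proof. by move=> w w' /queue_determined ->. Qed.

Lemma noise_cond_null n k : cond_null P (code n) (fun w => zeta n w k 0).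
Proof.
under eq_fun do rewrite noise_sum.
have fm := code_measurable (n:=n).
apply: cond_null_sum => // j; apply: cond_nullZ => //.
apply: cond_nullD => //; first apply: cond_nullD => //.
- exact: arrival_cond_null.
- apply: cond_null_sum => // k'; apply: cond_null_mul => //.
    exact: busy_determined.
  exact: transfer_cond_null.
- apply: cond_null_mul => //; last exact: service_cond_null.
  by move=> w w' ww'; rewrite (busy_determined j ww').
Qed.

Lemma noise_determined n k : determined (code n.+1) (fun w => zeta n w k 0).
Proof.
move=> w w' ww'; rewrite (queue_determined ww').
have ww'' := path_code_refine ww'.
by rewrite (queue_determined ww'') (allocation_determined ww'').
Qed.

Lemma path_code_martingale_cvg (X : nat -> T -> R) (b : nat -> R) :
  (forall n, determined (code n.+1) (X n)) ->
  (forall n, cond_null P (code n) (X n)) ->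
  (forall n w, `|X n w| <= b n) ->
  cvgn (series (fun n => b n ^+ 2)) ->
  {ae P, forall w, cvgn (series (X^~ w))}.
Proof.
move=> Xd Xn; apply: (martingale_cvg code_measurable path_code_refine Xd) => n.
by case: (Xn n).
Qed.

(** * Uniform bounds *)

Hypothesis nu_gt0 : forall k, 0 < nu k 0.

(** One bound for noise and gap in all coordinates, a sum standing in for a maximum. The [1] and the
    inverse of [mu k] come from [mu_k p_k <= 1]. *)
Let B : R := \sum_k ((\sum_j `|A k j| * K.+2%:R) + (nu k 0 + 1))
  + \sum_k ((mu k)^-1 + nu k 0 / mu k).

Let B_ge1 k : 0 <= (\sum_j `|A k j| * K.+2%:R) + (nu k 0 + 1).
Proof. by rewrite !addr_ge0 ?sumr_ge0// ?ltW// => j _; rewrite mulr_ge0. Qed.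

Let B_ge2 k : 0 <= (mu k)^-1 + nu k 0 / mu k.
Proof. by rewrite addr_ge0 ?divr_ge0 ?invr_ge0 ?ltW. Qed.

Lemma noise_le n w k : `|zeta n w k 0| <= B.
Proof.
apply: le_trans (_ : (\sum_j `|A k j| * K.+2%:R) + (nu k 0 + 1) <= _); last first.
  apply: le_trans (_ : \sum_k' ((\sum_j `|A k' j| * K.+2%:R) + (nu k' 0 + 1)) <= _).
    by rewrite [leRHS](bigD1 k)//= lerDl sumr_ge0.
  by rewrite lerDl sumr_ge0.
rewrite noiseE (le_trans (ler_normB _ _))// lerD//.
  rewrite mxE (le_trans (ler_norm_sum _ _ _))// ler_sum// => j _.
  by rewrite normrM ler_wpM2l// increment_le.
rewrite mxE (le_trans (ler_normB _ _))// lerD//.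
  by rewrite gtr0_norm.
have p1 := allocations_le k rate_lt1 (allocation_feasible n w).
have p0' := allocations_ge0 alpha_gt0 k (allocation_feasible n w).
rewrite ger0_norm; last by rewrite mulr_ge0 ?ler0n// mulr_ge0// ltW.
case: (@busy01 R K (Q n w) k) => ->; first by rewrite mul0r.
by rewrite mul1r.
Qed.

Lemma gap_le n w k : `|p n w k 0 - optimum mu lam rt k 0| <= B.
Proof.
apply: le_trans (_ : (mu k)^-1 + nu k 0 / mu k <= _); last first.
  apply: le_trans (_ : \sum_k' ((mu k')^-1 + nu k' 0 / mu k') <= _).
    by rewrite [leRHS](bigD1 k)//= lerDl sumr_ge0.
  by rewrite lerDr sumr_ge0.
have p1 := allocations_le k rate_lt1 (allocation_feasible n w).
have p0' := allocations_ge0 alpha_gt0 k (allocation_feasible n w).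
rewrite (le_trans (ler_normB _ _))// lerD//.
  by rewrite ger0_norm// -[leRHS]mul1r ler_pdivlMr// mulrC.
by rewrite mxE ger0_norm// divr_ge0// ltW.
Qed.

(** * Almost sure convergence *)

Hypothesis rt_sub : substochastic rt.
Hypothesis lam_cap : capacity_region S mu alpha rt lam.
Hypothesis eps0_le : forall k, eps0 <= nu k 0 / mu k.
Hypothesis beta_gt0 : forall n, 0 < beta n.
Hypothesis beta_sq_sum : cvgn (series (fun n => beta n ^+ 2)).
Hypothesis beta_lim : cvgn (fun n => (n%:R * beta n)^-1).

Lemma harmonic_le_beta : exists c, forall n, n.+1%:R^-1 <= c * beta n.
Proof.
have [M [_ hM]] := cvg_seq_bounded beta_lim.
have {}hM n : `|(n%:R * beta n)^-1| <= M + 1 by apply: hM => //; rewrite ltrDl.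
have M0 : 0 <= M + 1 by exact: le_trans (normr_ge0 _) (hM 0%N).
(* At index 0 the bounded sequence takes the value [0^-1 = 0] and says nothing; the term in [beta 0]
   covers that case. *)
exists (M + 1 + (beta 0%N)^-1) => -[|n].
  by rewrite invr1 mulrDl mulVf ?gt_eqF// lerDr mulr_ge0// ltW.
apply: le_trans (_ : (M + 1) * beta n.+1 <= _); last first.
  by rewrite ler_wpM2r ?lerDl ?invr_ge0// ltW.
apply: le_trans (_ : n.+1%:R^-1 <= _).
  by rewrite lef_pV2 ?posrE// ler_nat.
have := ler_wpM2r (ltW (beta_gt0 n.+1)) (le_trans (ler_norm _) (hM n.+1)).
by rewrite invfM -mulrA mulVf ?gt_eqF// mulr1.
Qed.

(** The coefficients of the noise are known at time [n], and the increments are bounded by a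
    multiple of [beta n], which is square summable. *)
Lemma lyapunov_noise_cvg : {ae P, forall w, cvgn (series (fun n =>
  beta n * \sum_k busy (Q n w) k * (p n w k 0 - optimum mu lam rt k 0) *
    zeta n w k 0))}.
Proof.
apply: (path_code_martingale_cvg (b := fun n => \sum_(k < K) (B * B) * beta n)).
- move=> n w w' ww'; have ww'' := path_code_refine ww'.
  congr (_ * _); apply: eq_bigr => k _.
  by rewrite (noise_determined k ww') (busy_determined k ww'')
    (allocation_determined ww'').
- move=> n; have fm := code_measurable (n:=n).
  apply: cond_nullZ => //; apply: cond_null_sum => // k.
  apply: cond_null_mul => //; last exact: noise_cond_null.
  by move=> w w' ww'; rewrite (busy_determined k ww') (allocation_determined ww').
- move=> n w; rewrite normrM gtr0_norm// -mulr_suml mulrC.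
  rewrite ler_wpM2r ?(ltW (beta_gt0 n))// (le_trans (ler_norm_sum _ _ _))//.
  apply: ler_sum => k _.
  have B0 : 0 <= B := le_trans (normr_ge0 _) (noise_le n w k).
  rewrite !normrM ler_pM ?mulr_ge0 ?noise_le// -[leRHS]mul1r ler_pM ?gap_le//.
  by case: (@busy01 R K (Q n w) k) => ->; rewrite ?normr0 ?normr1.
- rewrite (_ : (fun n => _) = (\sum_(k < K) (B * B)) ^+ 2 *: (fun n => beta n ^+ 2)).
    exact: is_cvg_seriesZ.
  by apply/funext => n; rewrite -mulr_suml exprMn.
Qed.

(** The bounds [B / (n + 1)] are square summable, being at most [B * c * beta n]. *)
Lemma average_noise_cvg k :
  {ae P, forall w, cvgn (series (fun n => zeta n w k 0 / n.+1%:R))}.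
Proof.
have [c hc] := harmonic_le_beta.
apply: (path_code_martingale_cvg (b := fun n => B / n.+1%:R)).
- by move=> n w w' ww'; rewrite (noise_determined k ww').
- move=> n; have fm := code_measurable (n:=n).
  under eq_fun do rewrite mulrC.
  by apply: cond_nullZ => //; exact: noise_cond_null.
- by move=> n w; rewrite normrM normfV normr_nat ler_wpM2r// noise_le.
- apply: (@series_le_cvg _ _ ((B * c) ^+ 2 *: (fun n => beta n ^+ 2))).
  + by move=> n; rewrite sqr_ge0.
  + by move=> n; rewrite !fctE mulr_ge0 ?sqr_ge0.
  + move=> n; rewrite !fctE [leRHS](_ : _ = B ^+ 2 * (c * beta n) ^+ 2).
      by rewrite exprMn ler_wpM2l ?sqr_ge0// lerXn2r ?nnegrE// (le_trans _ (hc n)).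
    by rewrite /GRing.scale/=; ring.
  + exact: is_cvg_seriesZ.
Qed.

Lemma allocation_cvg :
  {ae P, forall w, p ^~ w @ \oo --> optimum mu lam rt}.
Proof.
have [c hc] := harmonic_le_beta.
have avg : {ae P, forall w k, cvgn (series (fun n => zeta n w k 0 / n.+1%:R))}.
  (* There are finitely many coordinates, so a single null set serves for all. *)
  by apply: filter_forall => k; exact: average_noise_cvg.
apply: filterS2 lyapunov_noise_cvg avg => w wl wa.
apply: (@path_cvg R K mu lam rt mu_gt0 rt_sub rt_open nu_gt0
  (allocations_ge S alpha eps0) B _ _ beta beta_gt0 beta_sq_sum c hc (Q ^~ w)) => //.
- exact: allocations_ge_convex.
- exact: optimum_allocations.
- by move=> n k; exact: noise_le.
- by move=> n k; exact: gap_le.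
Qed.

End Process.

Theorem theorem3
  (R : realType) (K J : nat)
  (S : 'I_K -> {set 'I_J}) (mu : 'I_K -> R) (alpha : 'I_J -> R)
  (lam : 'cV[R]_K) (rt : 'M[R]_K)
  (S_neq0 : forall k, S k != finset.set0)
  (T_neq0 : forall j, served_queues S j != finset.set0)
  (mu_gt0 : forall k, 0 < mu k)
  (alpha_gt0 : forall j, 0 < alpha j)
  (rate_lt1 : forall (x : 'M[R]_(K, J)) (k : 'I_K),
     feasible S x -> service_rate S mu alpha x k < 1)
  (lam01 : forall k, 0 <= lam k 0 <= 1)
  (rt_sub : substochastic rt)
  (rt_open : 1%:M - rt^T \in unitmx)
  (nu_gt0 : forall k, 0 < nominal_rates rt lam k 0)
  (lam_cap : capacity_region S mu alpha rt lam)
  (eps0 : R) (eps0_gt0 : 0 < eps0)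
  (eps0_le : forall k, eps0 <= nominal_rates rt lam k 0 / mu k)
  (beta : nat -> R)
  (beta_gt0 : forall n, 0 < beta n)
  (beta_decr : {homo beta : m n / (m <= n)%N >-> n <= m})
  (beta_sum : series beta @ \oo --> +oo)
  (beta_sq_sum : cvgn (series (fun n => beta n ^+ 2)))
  (beta_lim : cvgn (fun n => (n%:R * beta n)^-1))
  (d : measure_display) (T : measurableType d) (P : probability T R)
  (Q : nat -> T -> 'I_K -> nat) (p : nat -> T -> 'cV[R]_K)
  (a s : nat -> 'I_K -> {RV P >-> bool})
  (r : nat -> 'I_K -> 'I_K -> {RV P >-> bool})
  (r_le1 : forall n k' k1 k2 w, r n k' k1 w -> r n k' k2 w -> k1 = k2)
  (q0 : 'I_K -> nat) (Q_init : forall w, Q 0%N w = q0)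
  (p0 : 'cV[R]_K) (p0_alloc : allocations S alpha p0)
  (p_init : forall w, p 0%N w = p0)
  (Q_step : forall n w,
     queue_step (Q n w) (Q n.+1 w) (fun k => a n k w) (fun k => s n k w)
       (fun k' k => r n k' k w))
  (p_step : forall n w,
     is_projection (allocations_ge S alpha eps0)
       (p n w + beta n *: (nonempty_mx (Q n w) *m invmx (1%:M - rt^T)
                             *m increment (Q n w) (Q n.+1 w)))
       (p n.+1 w))
  (sources_indep : forall n,
     cond_independent P (history Q p n)
       (source_sigma (fun k => a n k : T -> bool) (fun k => s n k : T -> bool)
          (fun k' k => r n k' k : T -> bool)))
  (a_law : forall n k,
     is_cond_prob P (history Q p n) (a n k @^-1` [set true])
       (fun=> lam k 0))
  (s_law : forall n k,
     is_cond_prob P (history Q p n) (s n k @^-1` [set true])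
       (fun w => mu k * p n w k 0))
  (r_law : forall n k' k,
     is_cond_prob P (history Q p n) (r n k' k @^-1` [set true])
       (fun=> rt k' k)) :
  {ae P, forall w,
     p ^~ w @ \oo --> (\col_k (nominal_rates rt lam k 0 / mu k) : 'cV[R]_K)}.
Proof.
exact: (@allocation_cvg R K J S mu alpha lam rt mu_gt0 alpha_gt0 rate_lt1 rt_open
  eps0 beta d T P Q p a s r q0 Q_init p0 p0_alloc p_init Q_step p_step).
Qed.
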